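(* Let $G$ be a locally compact group, $(\Phi,\Psi)$ a pair of complementary Young functions satisfying the $\Delta_2$-condition, and $\{\pi,\mathcal{H}\}$ a non-degenerate $*$-representation of $A_\Phi(G)$ on a Hilbert space $\mathcal{H}$. (i) For each $u\in B_\Phi(G)$ there exists a unique operator $\widetilde{\pi}(u)\in\mathcal{B}(\mathcal{H})$ such that, for all $v\in A_\Phi(G)$, $$\widetilde{\pi}(u)\pi(v)=\pi(uv)\quad\text{and}\quad \widetilde{\pi}(v)=\pi(v).$$ (ii) The mapping $u\mapsto\widetilde{\pi}(u)$ defines a non-degenerate $*$-representation of $B_\Phi(G)$ on $\mathcal{H}$.
   Context: A Young function is an even convex function $\Phi:\mathbb{R}\to[0,\infty)$ with $\Phi(0)=0$ and $\Phi(x)\to\infty$ as $x\to\infty$; its complementary function is $\Psi(y)=\sup\{x|y|-\Phi(x):x\ge 0\}$, here also assumed finite-valued. The pair $(\Phi,\Psi)$ satisfies the $\Delta_2$-condition if for each $\Theta\in\{\Phi,\Psi\}$ there are $K>0$ and $x_0>0$ with $\Theta(2x)\le K\Theta(x)$ for all $x\ge x_0$ if $G$ is compact, and the same inequality holds for all $x\geq 0$ if $G$ is non-compact. With respect to a left Haar measure, $L^\Phi(G)$ is the Orlicz space of (classes of) measurable functions $f:G\to\mathbb{C}$ with $\int_G\Phi(\beta|f|)\,dx<\infty$ for some $\beta>0$; $N_\Phi(f)=\inf\{k>0:\int_G\Phi(|f|/k)\,dx\le 1\}$ is the gauge norm, and for $g\in L^\Psi(G)$, $\|g\|_\Psi=\sup\{\int_G|fg|\,dx:\int_G\Phi(|f|)\,dx\le1\}$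 is the Orlicz norm. Put $\check g(x)=g(x^{-1})$ and $(f*\check g)(x)=\int_G f(y)g(x^{-1}y)\,dy$. $A_\Phi(G)$ is the space of all continuous functions $u$ on $G$ of the form $u=\sum_{n=1}^\infty f_n*\check g_n$ with $f_n\in L^\Phi(G)$, $g_n\in L^\Psi(G)$, $\sum_n N_\Phi(f_n)\|g_n\|_\Psi<\infty$, normed by the infimum of $\sum_n N_\Phi(f_n)\|g_n\|_\Psi$ over all such representations. With pointwise operations it is a regular, Tauberian, semisimple commutative Banach algebra with Gelfand spectrum $G$ (via point evaluations); the involution is complex conjugation $u\mapsto\bar u$. $B_\Phi(G)$ is the multiplier algebra of $A_\Phi(G)$: the algebra of continuous functions $u$ on $G$ with $uv\in A_\Phi(G)$ for all $v\in A_\Phi(G)$, with pointwise operations, complex conjugation as involution, and norm $\|u\|_{B_\Phi}=\sup\{\|uv\|_{A_\Phi}:\|v\|_{A_\Phi}\le1\}$. Thus $A_\Phi(G)\subseteq B_\Phi(G)$. For $\mathcal{A}=A_\Phi(G)$ or $B_\Phi(G)$, a $*$-representation $\{\pi,\mathcal{H}\}$ of $\mathcal{A}$ is a $*$-homomorphism $\pi:\mathcal{A}\to\mathcal{B}(\mathcal{H})$; it is non-degenerate if the span of $\{\pi(u)\xi:u\in\mathcal{A},\xi\in\mathcal{H}\}$ is dense in $\mathcal{H}$. *)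

(* Defs.v *)
From HB Require Import structures.
From mathcomp Require Import all_boot all_order all_algebra.
From mathcomp Require Import sesquilinear complex.
From mathcomp Require Import all_classical all_reals all_analysis.

Set Implicit Arguments.
Unset Strict Implicit.
Unset Printing Implicit Defensive.

Import Order.TTheory GRing.Theory Num.Theory.
Import numFieldNormedType.Exports.

Local Open Scope classical_set_scope.
Local Open Scope ring_scope.

HB.mixin Record isTopologicalGroup G of Group G & Topological G := {
  mulg_continuous : continuous (fun xy : G * G => (xy.1 * xy.2)%g) ;
  invg_continuous : continuous (fun x : G => x^-1%g)
}.

(* Pointedness carries no content for a group; the library requires it of
   measurable spaces. *)
#[short(type=topologicalGroupType)]
HB.structure Definition TopologicalGroup :=
  {G of Group G & PointedTopological G & isTopologicalGroup G}.

(* The type T equipped with its Borel sigma-algebra. *)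
Definition borel (T : ptopologicalType) := g_sigma_algebraType (@open T).

Definition left_haar (R : realType) (G : topologicalGroupType)
    (mu : {measure set (borel G) -> \bar R}) : Prop :=
  [/\ mu [set: G] != 0%E,
      forall K : set G, compact K -> (mu K < +oo)%E,
      forall A : set G, measurable (A : set (borel G)) ->
        mu A = ereal_inf [set mu U | U in [set U : set G | open U /\ A `<=` U]],
      forall U : set G, open U ->
        mu U = ereal_sup [set mu K | K in [set K : set G | compact K /\ K `<=` U]]
    & forall (x : G) (A : set G), measurable (A : set (borel G)) ->
        mu [set (x * y)%g | y in A] = mu A].

Section young.
Variable R : realType.
Implicit Types Phi Psi Theta : R -> R.

Definition young_function Phi : Prop :=
  [/\ forall x, 0 <= Phi x,
      forall x, Phi (- x) = Phi x,
      @convex_function R R^o setT Phi,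
      Phi 0 = 0
    & Phi x @[x --> +oo] --> +oo].

(* Psi is real-valued, so this includes finiteness of the supremum. *)
Definition complementary Phi Psi : Prop := forall y,
  (Psi y)%:E = ereal_sup [set (x * `|y| - Phi x)%:E | x in [set x | 0 <= x]].

Definition delta2 (G : topologicalType) Theta : Prop :=
  exists K x0 : R, [/\ 0 < K, 0 < x0,
    compact [set: G] -> forall x, x0 <= x -> Theta (2 * x) <= K * Theta x
  & ~ compact [set: G] -> forall x, 0 <= x -> Theta (2 * x) <= K * Theta x].

End young.

Section orlicz.
Context {R : realType} {G : topologicalGroupType}.
Variable mu : {measure set (borel G) -> \bar R}.
Implicit Types (Phi Psi : R -> R) (f g u : G -> R[i]).

(* The modulus as an element of R; `|z| lives in R[i]. *)
Local Notation modulus := Normc.normc.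

Definition cmeasurable f : Prop :=
  measurable_fun setT (fun x : borel G => complex.Re (f x)) /\
  measurable_fun setT (fun x : borel G => complex.Im (f x)).

Definition cintegral f : R[i] :=
  Complex (\int[mu]_x complex.Re (f x)) (\int[mu]_x complex.Im (f x)).

Definition modular Phi f : \bar R :=
  (\int[mu]_x (Phi (modulus (f x)))%:E)%E.

Definition orlicz_space Phi : set (G -> R[i]) :=
  [set f | cmeasurable f /\
    exists2 b : R, 0 < b & (modular Phi (fun x => b%:C%C * f x)%R < +oo)%E].

Definition gauge_norm Phi f : \bar R :=
  ereal_inf [set k%:E | k in
    [set k : R | 0 < k /\ (modular Phi (fun x => k^-1%:C%C * f x)%R <= 1)%E]].

(* The Orlicz norm of L^Psi is defined by duality from Phi. *)
Definition orlicz_norm Phi g : \bar R :=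
  ereal_sup [set (\int[mu]_x (modulus (f x * g x))%:E)%E | f in
    [set f | cmeasurable f /\ (modular Phi f <= 1)%E]].

(* (f * g^vee)(x) where g^vee(x) = g(x^-1) *)
Definition conv_check f g : G -> R[i] :=
  fun x => cintegral (fun y => f y * g (x^-1 * y)%g).

Definition A_Phi Phi Psi : set (G -> R[i]) :=
  [set u | continuous (u : G -> R[i]^o) /\
    exists f g : nat -> G -> R[i],
    [/\ forall n, orlicz_space Phi (f n),
        forall n, orlicz_space Psi (g n),
        (\sum_(0 <= n <oo) (gauge_norm Phi (f n) * orlicz_norm Phi (g n))
           < +oo)%E
      & forall x, (series (fun n => conv_check (f n) (g n) x) : nat -> R[i]^o)
          @ \oo --> (u x : R[i]^o)]].

Definition B_Phi Phi Psi : set (G -> R[i]) :=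
  [set u | continuous (u : G -> R[i]^o) /\
    forall v, A_Phi Phi Psi v -> A_Phi Phi Psi (u \* v)].

End orlicz.

Section representation.
Context {R : realType} {H : completeNormedModType R[i]}.

(* H is a Hilbert space with inner product ip. *)
Definition hilbert_norm (ip : {dot H for Num.conj}) : Prop :=
  forall x : H, `|x| ^+ 2 = ip x x.

Definition bounded_operator (T : H -> H) : Prop :=
  (forall (a : R[i]) (x y : H), T (a *: x + y) = a *: T x + T y) /\
  exists M : R[i], forall x, `|T x| <= M * `|x|.

Context {X : Type}.
Implicit Types (S : set (X -> R[i])) (pi : (X -> R[i]) -> H -> H).

(* S is meant to be an algebra of functions closed under conjugation; the
   values of pi outside S are irrelevant. *)
Definition star_representation (ip : {dot H for Num.conj}) S pi : Prop :=
  [/\ forall u, S u -> bounded_operator (pi u),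
      forall (a : R[i]) u v, S u -> S v ->
        pi (fun x => a * u x + v x) = fun xi => a *: pi u xi + pi v xi,
      forall u v, S u -> S v -> pi (u \* v) = pi u \o pi v
    & forall u, S u -> forall xi eta : H,
        ip (pi u xi) eta = ip xi (pi (fun x => (u x)^*) eta)].

Definition nondegenerate_representation S pi : Prop :=
  dense [set eta : H | exists n (c : 'I_n -> R[i]) (u : 'I_n -> X -> R[i])
    (xi : 'I_n -> H), (forall i, S (u i)) /\
    eta = \sum_(i < n) c i *: pi (u i) (xi i)].

End representation.

(* Main.v *)
Require Import Defs.
From HB Require Import structures.
From mathcomp Require Import all_boot all_order all_algebra.
From mathcomp Require Import sesquilinear complex.
From mathcomp Require Import all_classical all_reals all_analysis.
From mathcomp Require Import measurable_realfun.
From mathcomp Require Import ring lra.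

Set Implicit Arguments.
Unset Strict Implicit.
Unset Printing Implicit Defensive.

Import Order.TTheory GRing.Theory Num.Theory.
Import numFieldNormedType.Exports.

Local Open Scope classical_set_scope.
Local Open Scope ring_scope.

(** Positivity drives the extension. Let eta = sum_i pi(v_i) xi_i, and let u be
    a multiplier of A_Phi. The operator to be built must send eta to
    zeta = sum_i pi(u v_i) xi_i, and everything rests on an estimate
    |zeta| <= c |eta| with c depending on u only ([rep_sum_bound]). If s is a
    real function with s ^ 2 = 1 - |u / c| ^ 2 such that s v is in A_Phi for all
    v in A_Phi, then moving the representation to one side of the inner product
    gives |eta| ^ 2 - |zeta| ^ 2 / c ^ 2 = |sum_i pi(s v_i) xi_i| ^ 2 >= 0.

    Two properties of A_Phi produce s. It is a Banach space with continuous
    point evaluations ([A_Phi_function_norm]), so multiplication by u is bounded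
    on it, by a closed graph argument ([multiplication_bounded]); and when c is
    twice a bound of this operator, the square root exists in the algebra of
    multiplication operators, as the limit of a contracting iteration
    ([multiplier_square_root]). That A_Phi is a Banach space comes from a Hölder
    inequality between the gauge norm and the Orlicz norm ([orlicz_holder]),
    which bounds convolutions uniformly, and from the merging of countably many
    representations into one ([A_Phi_series]).

    By the estimate, zeta depends boundedly on eta, which ranges over a dense
    subspace, so the operator extends to the whole space
    ([bounded_graph_extension]). Density of the range of pi also makes it the
    only solution of the intertwining relation, and uniqueness then yields the
    algebraic properties of the extended representation
    ([multiplier_representation]). *)

Local Notation modulus := Normc.normc.

(** * Complex numbers: modulus and convergence *)

Section complex_modulus.
Variable R : realType.
Implicit Types z w : R[i].

Lemma normr_modulus z : `|z| = (modulus z)%:C%C.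
Proof. by case: z => a b; rewrite normc_def. Qed.

Lemma modulus_ge0 z : 0 <= modulus z.
Proof. by case: z => a b; exact: sqrtr_ge0. Qed.

Lemma modulus_conj z : modulus z^* = modulus z.
Proof. by case: z => a b /=; rewrite sqrrN. Qed.

Lemma modulus_real (x : R) : modulus x%:C%C = `|x|.
Proof. by rewrite /= expr0n/= addr0 sqrtr_sqr. Qed.

Lemma Re_le_modulus z : `|complex.Re z| <= modulus z.
Proof.
case: z => a b /=; rewrite -sqrtr_sqr ler_sqrt ?addr_ge0 ?sqr_ge0//.
by rewrite lerDl sqr_ge0.
Qed.

Lemma Im_le_modulus z : `|complex.Im z| <= modulus z.
Proof.
case: z => a b /=; rewrite -sqrtr_sqr ler_sqrt ?addr_ge0 ?sqr_ge0//.
by rewrite lerDr sqr_ge0.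
Qed.

Lemma modulus_le z : modulus z <= `|complex.Re z| + `|complex.Im z|.
Proof.
case: z => a b /=; rewrite -[leRHS]ger0_norm ?addr_ge0// -sqrtr_sqr.
rewrite ler_sqrt ?sqr_ge0// sqrrD !real_normK ?num_real//.
by rewrite addrAC lerDl mulrn_wge0// mulr_ge0.
Qed.

Lemma complex_eqP z w :
  complex.Re z = complex.Re w -> complex.Im z = complex.Im w -> z = w.
Proof. by case: z w => [a b] [c d] /= -> ->. Qed.

Lemma ReD z w : complex.Re (z + w) = complex.Re z + complex.Re w.
Proof. by case: z w => [a b] [c d]. Qed.
Lemma ImD z w : complex.Im (z + w) = complex.Im z + complex.Im w.
Proof. by case: z w => [a b] [c d]. Qed.
Lemma ReN z : complex.Re (- z) = - complex.Re z.
Proof. by case: z => [a b]. Qed.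
Lemma ImN z : complex.Im (- z) = - complex.Im z.
Proof. by case: z => [a b]. Qed.
Lemma ReM z w : complex.Re (z * w) =
  complex.Re z * complex.Re w - complex.Im z * complex.Im w.
Proof. by case: z w => [a b] [c d]. Qed.
Lemma ImM z w : complex.Im (z * w) =
  complex.Re z * complex.Im w + complex.Im z * complex.Re w.
Proof. by case: z w => [a b] [c d]. Qed.

Lemma Re_sum (I : Type) (r : seq I) (P : pred I) (z : I -> R[i]) :
  complex.Re (\sum_(i <- r | P i) z i) = \sum_(i <- r | P i) complex.Re (z i).
Proof. by apply: (big_morph _ ReD). Qed.
Lemma Im_sum (I : Type) (r : seq I) (P : pred I) (z : I -> R[i]) :
  complex.Im (\sum_(i <- r | P i) z i) = \sum_(i <- r | P i) complex.Im (z i).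
Proof. by apply: (big_morph _ ImD). Qed.

Section cvg.
Variables (T : Type) (F : set_system T) (FF : Filter F).

Lemma cvgC_modulus (f : T -> R[i]) (l : R[i]) :
  (f t : R[i]^o) @[t --> F] --> (l : R[i]^o) <->
  forall e : R, 0 < e -> \forall t \near F, modulus (l - f t) < e.
Proof.
split=> [/cvgrPdist_lt fl e e0|fl].
  have := fl e%:C%C; rewrite ltcR => /(_ e0).
  by apply: filterS => t; rewrite normr_modulus ltcR.
apply/cvgrPdist_lt => e e0.
have eE : e = (complex.Re e)%:C%C by rewrite RRe_real// gtr0_real.
have := fl (complex.Re e); rewrite -ltcR -eE => /(_ e0).
by apply: filterS => t; rewrite normr_modulus eE ltcR.
Qed.

Lemma cvg_complex (f : T -> R[i]) (l : R[i]) :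
  (f t : R[i]^o) @[t --> F] --> (l : R[i]^o) <->
  complex.Re (f t) @[t --> F] --> complex.Re l /\
  complex.Im (f t) @[t --> F] --> complex.Im l.
Proof.
split=> [/cvgC_modulus fl|[/cvgrPdist_lt fr /cvgrPdist_lt fi]].
  split; apply/cvgrPdist_lt => e /fl; apply: filterS => t.
    by rewrite -ReN -ReD; exact/le_lt_trans/Re_le_modulus.
  by rewrite -ImN -ImD; exact/le_lt_trans/Im_le_modulus.
apply/cvgC_modulus => e e0; have e20 : 0 < e / 2 by rewrite divr_gt0.
apply: filterS2 (fr _ e20) (fi _ e20) => t rt it.
rewrite (le_lt_trans (modulus_le _))// ReD ImD ReN ImN [ltRHS](splitr e).
exact: ltrD.
Qed.

Lemma cvg_complexM (f g : T -> R[i]) (a b : R[i]) :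
  (f t : R[i]^o) @[t --> F] --> (a : R[i]^o) ->
  (g t : R[i]^o) @[t --> F] --> (b : R[i]^o) ->
  (f t * g t : R[i]^o) @[t --> F] --> (a * b : R[i]^o).
Proof. exact: cvgM. Qed.

Lemma cvg_conj (f : T -> R[i]) (l : R[i]) :
  (f t : R[i]^o) @[t --> F] --> (l : R[i]^o) ->
  ((f t)^* : R[i]^o) @[t --> F] --> (l^* : R[i]^o).
Proof.
have ReJ z : complex.Re z^* = complex.Re z by case: (z : R[i]).
have ImJ z : complex.Im z^* = - complex.Im z by case: (z : R[i]).
move=> /cvg_complex[fr fi]; apply/cvg_complex; split.
  by rewrite ReJ; under eq_fun do rewrite ReJ.
by rewrite ImJ; under eq_fun do rewrite ImJ; exact: cvgN.
Qed.

End cvg.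

Lemma modulus_lim_le (f : nat -> R[i]) (l : R[i]) (M : R) :
  (f n : R[i]^o) @[n --> \oo] --> (l : R[i]^o) ->
  (forall n, modulus (f n) <= M) -> modulus l <= M.
Proof.
move=> /cvgC_modulus fl fM; apply/ler_addgt0Pr => e e0.
have [n _ /(_ n (leqnn n)) ne] := fl _ e0.
have -> : l = (l - f n) + f n by rewrite subrK.
by rewrite (le_trans (le_normcD _ _))// addrC lerD// ltW.
Qed.

Lemma Re_series (u : nat -> R[i]) :
  (fun n => complex.Re (series u n)) = series (@complex.Re R \o u).
Proof. by apply/funext => n; rewrite /series/= Re_sum. Qed.
Lemma Im_series (u : nat -> R[i]) :
  (fun n => complex.Im (series u n)) = series (@complex.Im R \o u).
Proof. by apply/funext => n; rewrite /series/= Im_sum. Qed.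

Lemma cvg_complex_series (u : nat -> R[i]) (l : R[i]) :
  (series u : nat -> R[i]^o) @ \oo --> (l : R[i]^o) <->
  series (@complex.Re R \o u) @ \oo --> complex.Re l /\
  series (@complex.Im R \o u) @ \oo --> complex.Im l.
Proof. by rewrite -Re_series -Im_series; exact: cvg_complex. Qed.

(** Completeness of the complex numbers, through that of the reals. *)
Lemma modulus_series_cvg (u : nat -> R[i]) (M : nat -> R) :
  (forall n, modulus (u n) <= M n) -> cvgn (series M) ->
  exists l : R[i], (series u : nat -> R[i]^o) @ \oo --> (l : R[i]^o).
Proof.
move=> uM cM.
have real_cvg (p : R[i] -> R) :
    (forall z, `|p z| <= modulus z) ->
    cvgn (series (p \o u)).
  move=> pM; apply: normed_cvg; apply: (series_le_cvg _ _ _ cM) => n //=.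
    by rewrite (le_trans _ (uM n))// modulus_ge0.
  exact: le_trans (pM _) (uM n).
exists (Complex (lim (series (@complex.Re R \o u) @ \oo))
                (lim (series (@complex.Im R \o u) @ \oo))).
apply/cvg_complex_series; split; apply: real_cvg.
  exact: Re_le_modulus.
exact: Im_le_modulus.
Qed.

End complex_modulus.

(** * Banach function spaces and bounded multiplication *)

Section series_tools.
Variable R : realType.

Lemma series_two (K : numFieldType) (V : pseudoMetricNormedZmodType K) (a b : V) :
  series (fun k : nat => if k == 0%N then a else if k == 1%N then b else 0)
    @ \oo --> a + b.
Proof.
apply: cvg_near_cst; exists 2%N => // -[|[|n]] //= _.
by rewrite /series/= big_nat_recl// big_nat_recl//= big1 ?addr0.
Qed.

Lemma series_telescope (f : nat -> R[i]) (l : R[i]) K :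
  (f n : R[i]^o) @[n --> \oo] --> (l : R[i]^o) ->
  (series (fun k => f (k + K).+1 - f (k + K)%N) : nat -> R[i]^o) @ \oo
    --> (l - f K : R[i]^o).
Proof.
move=> fl.
have -> : series (fun k => f (k + K).+1 - f (k + K)%N) =
    fun n => f (n + K)%N - f K.
  by apply/funext => n; rewrite /series/= (telescope_sumr (fun k => f (k + K)%N)).
apply: cvgB; last exact: cvg_cst.
by rewrite -(cvg_shiftn K) in fl.
Qed.

Lemma series_half (a : R) : series (fun k => a * 2^-1 ^+ k) @ \oo --> 2 * a.
Proof.
have -> : 2 * a = a * (1 - 2^-1)^-1 by field.
by apply: cvg_geometric_series; rewrite ger0_norm ?invf_lt1 ?ltr1n.
Qed.

End series_tools.

(** A Banach space of functions, closed under conjugation and with continuous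
    point evaluations, presented through upper bounds of its norm: [nb v M]
    stands for the membership of [v] together with the bound M for its norm.
    A norm that is an infimum over representations is thus handled through the
    representations themselves, and no attainment question arises. Clause
    [nb_series] combines completeness with the triangle inequality. *)
Record function_norm (R : realType) (X : Type)
    (nb : (X -> R[i]) -> R -> Prop) : Prop := FunctionNorm {
  nb_eval : forall v M x, nb v M -> modulus (v x) <= M ;
  nb_zero : nb (fun=> 0) 0 ;
  nb_weaken : forall v M N, nb v M -> M <= N -> nb v N ;
  nb_scale : forall a v M, nb v M -> nb (fun x => a * v x) (modulus a * M) ;
  nb_conj : forall v M, nb v M -> nb (fun x => (v x)^*) M ;
  nb_series : forall (v : nat -> X -> R[i]) (M : nat -> R) w S,
    (forall k, nb (v k) (M k)) -> series M @ \oo --> S ->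
    (forall x, (series (fun k => v k x) : nat -> R[i]^o) @ \oo
                 --> (w x : R[i]^o)) ->
    nb w S }.

Section function_norm_theory.
Variables (R : realType) (X : Type) (nb : (X -> R[i]) -> R -> Prop).
Hypothesis nbP : function_norm nb.
Implicit Types (u v w : X -> R[i]) (M N : R).

Definition finite_norm v := exists M, nb v M.

Lemma nb_add v w M N :
  nb v M -> nb w N -> nb (fun x => v x + w x) (M + N).
Proof.
move=> vM wN; apply: (nb_series nbP
  (v := fun k => if k == 0%N then v else if k == 1%N then w else fun=> 0)
  (M := fun k => if k == 0%N then M else if k == 1%N then N else 0)).
- by move=> [|[|k]] //=; exact: nb_zero.
- exact: (@series_two R R^o).
- move=> x.
  have -> : (fun k : nat => (if k == 0%N then v else
      if k == 1%N then w else fun=> 0) x) =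
      (fun k : nat => if k == 0%N then v x else if k == 1%N then w x else 0).
    by apply/funext => -[|[|k]].
  exact: (@series_two R[i] R[i]^o).
Qed.

Lemma nb_sub v w M N :
  nb v M -> nb w N -> nb (fun x => v x - w x) (M + N).
Proof.
move=> vM /(nb_scale nbP (-1)) wN.
have := nb_add vM wN; rewrite normcN Normc.normc1 mul1r.
by under eq_fun do rewrite mulN1r.
Qed.

Lemma nb_subC v w M : nb (fun x => v x - w x) M -> nb (fun x => w x - v x) M.
Proof.
move=> /(nb_scale nbP (-1)); rewrite normcN Normc.normc1 mul1r.
by under eq_fun do rewrite mulN1r opprB.
Qed.

Lemma finite_normP (a : R[i]) v w : finite_norm v -> finite_norm w ->
  finite_norm (fun x => a * v x + w x).
Proof.
by move=> [M vM] [N wN]; exists (modulus a * M + N); apply: nb_add => //; exact: nb_scale.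
Qed.

Lemma finite_norm_conj v : finite_norm v -> finite_norm (fun x => (v x)^*).
Proof. by move=> [M vM]; exists M; exact: (nb_conj nbP). Qed.

(** Every tail of the telescoping series of the steps is dominated by a
    geometric series, so completeness yields the limit and also its rate. *)
Lemma nb_limit (x : nat -> X -> R[i]) (r : nat -> R) :
  (forall n, nb (fun t => x n.+1 t - x n t) (r n)) ->
  (forall n, 0 < r n) -> (forall n, r n.+1 <= r n / 2) ->
  exists y, (forall t, (x n t : R[i]^o) @[n --> \oo] --> (y t : R[i]^o)) /\
    forall K, nb (fun t => y t - x K t) (2 * r K).
Proof.
move=> xr r0 rS.
have rK K k : r (k + K)%N <= r K * 2^-1 ^+ k.
  elim: k => [|k IH]; first by rewrite expr0 mulr1.
  rewrite addSn (le_trans (rS _))// exprSr mulrA ler_wpM2r//.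
have xK K k : nb (fun t => x (k + K).+1 t - x (k + K)%N t) (r K * 2^-1 ^+ k).
  exact: nb_weaken (xr _) (rK _ _).
have xcvg t : exists l : R[i], (x n t : R[i]^o) @[n --> \oo] --> (l : R[i]^o).
  have half : cvgn (series (fun k => r 0%N * 2^-1 ^+ k)).
    by apply/cvg_ex; exists (2 * r 0%N); exact: series_half.
  have [l] := @modulus_series_cvg R (fun k => x (k + 0).+1 t - x (k + 0)%N t) _
    (fun k => nb_eval nbP t (xK 0%N k)) half.
  move=> ul; exists (l + x 0%N t).
  have -> : (fun n => x n t) =
      (fun n => series (fun k => x (k + 0).+1 t - x (k + 0)%N t) n + x 0%N t).
    apply/funext => n; rewrite /series/=.
    by rewrite (telescope_sumr (fun k => x (k + 0)%N t))// addn0 subrK.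
  exact: cvgD ul (cvg_cst _).
have [y xy] := choice xcvg.
exists y; split=> // K.
apply: (nb_series nbP (xK K)); first exact: series_half.
move=> t.
exact: (series_telescope (f := fun n => x n t)).
Qed.

Section closed_graph.
Variable u : X -> R[i].
Hypothesis uB : forall v, finite_norm v -> finite_norm (u \* v).

(** The Baire category argument: otherwise there are nested balls, the n-th of
    which avoids all functions w with the norm of u w at most n, and the common
    point y of these balls contradicts the finiteness of the norm of u y. *)
Lemma mul_image_dense_in_ball : exists n (v0 : X -> R[i]) r,
  [/\ finite_norm v0, 0 < r & forall v, nb (fun x => v x - v0 x) r ->
    forall e, 0 < e -> exists2 w, nb (u \* w) n%:R & nb (fun x => v x - w x) e].
Proof.
apply: contrapT => /forallNP noball.
have step (n : nat) (p : {p : (X -> R[i]) * R | finite_norm p.1 /\ 0 < p.2}) :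
    exists q : {p : (X -> R[i]) * R | finite_norm p.1 /\ 0 < p.2},
    [/\ nb (fun x => (sval q).1 x - (sval p).1 x) (sval p).2,
        (sval q).2 <= (sval p).2 / 2
      & forall w, nb (u \* w) n%:R ->
          ~ nb (fun x => (sval q).1 x - w x) (2 * (sval q).2)].
  case: p => -[v0 r] /= [v0A r0].
  have /forallNP/(_ v0)/forallNP/(_ r) := noball n.
  move=> /not_and3P; case=> [//|//|].
  move=> /existsNP[v /not_implyP[vr /existsNP[e /not_implyP[e0 vw]]]].
  have vA : finite_norm v.
    have [M v0M] := v0A; exists (r + M).
    by have := nb_add vr v0M; under eq_fun do rewrite subrK.
  have m0 : 0 < Num.min e r / 2 by rewrite divr_gt0// lt_min e0.
  exists (exist _ (v, Num.min e r / 2) (conj vA m0)); split=> //=.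
    by rewrite ler_wpM2r// ge_min lexx orbT.
  move=> w uw vwe; apply: vw; exists w => //.
  apply: (nb_weaken nbP vwe).
  by rewrite mulrC divfK// ge_min lexx.
have zero_fin : finite_norm (fun=> 0) by exists 0; exact: nb_zero.
pose p0 : {p : (X -> R[i]) * R | finite_norm p.1 /\ 0 < p.2} :=
  exist _ (fun=> 0, 1) (conj zero_fin ltr01).
have [next nextP] := choice (fun np => step np.1 np.2).
pose st := fix st n := if n is m.+1 then next (m, st m) else p0.
pose x n := (sval (st n)).1; pose r n := (sval (st n)).2.
have [y [_ yK]] : exists y,
    (forall t, (x n t : R[i]^o) @[n --> \oo] --> (y t : R[i]^o)) /\
    forall K, nb (fun t => y t - x K t) (2 * r K).
  apply: nb_limit => n.
  - by have [] := nextP (n, st n).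
  - by rewrite /r; case: (st n) => -[? ?] [].
  - by have [] := nextP (n, st n).
have [M uyM] : finite_norm (u \* y).
  apply: uB; have := yK 0%N; rewrite /x/=; under eq_fun do rewrite subr0.
  by exists (2 * r 0%N).
pose n := Num.bound `|M|.
have [_ _ /(_ y)] := nextP (n, st n); apply.
  by apply: (nb_weaken nbP uyM); rewrite ltW// (le_lt_trans (ler_norm _))// archi_boundP.
by apply: nb_subC; exact: (yK n.+1).
Qed.

(** This is the closed graph theorem: the graph of multiplication by u is
    closed because point evaluations are continuous. The approximate preimages
    given by the category argument are improved by successive halving of the
    error, and the corrections add up to v. *)
Theorem multiplication_bounded :
  exists2 C, 0 < C & forall v M, 0 < M -> nb v M -> nb (u \* v) (C * M).
Proof.
have [n0 [v0 [r [v0A r0 ball]]]] := mul_image_dense_in_ball.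
have [C C0 approx] : exists2 C, 0 < C & forall v M, 0 < M -> nb v M ->
    exists2 w, nb (u \* w) (C * M) & nb (fun x => v x - w x) (M / 2).
  (* The factor 2 comes from subtracting approximants of v0 from those of
     v0 + c v; the successor keeps the constant positive. *)
  exists (2 * n0.+1%:R / r) => [|v M M0 vM]; first by rewrite divr_gt0// mulr_gt0.
  pose c := r / M; have c0 : 0 < c by exact: divr_gt0.
  have e0 : 0 < r / 4 by rewrite divr_gt0.
  have cv : nb (fun x => c%:C%C * v x) r.
    have := nb_scale nbP c%:C%C vM.
    by rewrite modulus_real gtr0_norm// /c divfK// gt_eqF.
  have [|w1 uw1 vw1] := ball (fun x => c%:C%C * v x + v0 x) _ _ e0.
    by under eq_fun do rewrite addrK.
  have [|w0 uw0 vw0] := ball v0 _ _ e0.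
    under eq_fun do rewrite subrr.
    exact: (nb_weaken nbP (nb_zero nbP) (ltW r0)).
  have c'0 : 0 < c^-1 by rewrite invr_gt0.
  exists (fun x => (c^-1)%:C%C * (w1 x - w0 x)).
    have := nb_scale nbP (c^-1)%:C%C (nb_sub uw1 uw0).
    rewrite modulus_real gtr0_norm//= => H.
    have -> : u \* (fun x => (c^-1)%:C%C * (w1 x - w0 x)) =
        fun x => (c^-1)%:C%C * (u x * w1 x - u x * w0 x).
      by apply/funext => x /=; ring.
    apply: (nb_weaken nbP H); rewrite /c invf_div -natrD addnn -mul2n natrM.
    have -> : 2 * n0.+1%:R / r * M = M / r * (2 * n0.+1%:R) by ring.
    by rewrite ler_wpM2l ?divr_ge0 ?ltW// ltr_pM2l// ltr_nat.
  have := nb_scale nbP (c^-1)%:C%C (nb_sub vw1 vw0).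
  have -> : modulus (c^-1)%:C%C * (r / 4 + r / 4) = M / 2.
    by rewrite modulus_real gtr0_norm// /c; field; rewrite !gt_eqF.
  congr nb; apply/funext => x /=.
  rewrite rmorphV/= ?unitfE ?gt_eqF//.
  have : (c%:C%C : R[i]) != 0 by rewrite -[0]/(0%:C%C) (inj_eq (@complexI _)) gt_eqF.
  by move=> ?; field.
exists (2 * C) => [|v M M0 vM]; first by rewrite mulr_gt0.
have MK0 k : 0 < M * 2^-1 ^+ k by rewrite mulr_gt0// exprn_gt0.
have correction (kv : nat * (X -> R[i])) : exists w : X -> R[i],
    nb kv.2 (M * 2^-1 ^+ kv.1) ->
    nb (u \* w) (C * (M * 2^-1 ^+ kv.1)) /\
    nb (fun x => kv.2 x - w x) (M * 2^-1 ^+ kv.1.+1).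
  case: kv => k z /=.
  have [zM|zM] := pselect (nb z (M * 2^-1 ^+ k)); last by exists z.
  have [e ue ze] := approx _ _ (MK0 k) zM; exists e => _; split=> //.
  by rewrite exprSr mulrA.
have [w wP] := choice correction.
pose z := fix z n := if n is m.+1 then (fun x => z m x - w (m, z m) x) else v.
have zM n : nb (z n) (M * 2^-1 ^+ n).
  elim: n => [|n IH] /=; first by rewrite expr0 mulr1.
  by have [] := wP (n, z n) IH.
apply: (nb_series nbP (v := fun k => u \* w (k, z k))
  (M := fun k => (C * M) * 2^-1 ^+ k)).
- by move=> k; rewrite -mulrA; have [] := wP (k, z k) (zM k).
- by rewrite -mulrA; exact: series_half.
move=> x.
have -> : series (fun k => (u \* w (k, z k)) x) = fun n => u x * (v x - z n x).
  apply/funext; elim=> [|n IH]; first by rewrite /series/= big_geq// subrr mulr0.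
  by rewrite /series/= big_nat_recr//= [X in X + _]IH; ring.
rewrite -[X in _ --> X]/(u x * v x) -{2}[v x]subr0.
apply: cvg_complexM; first exact: cvg_cst.
apply: (@cvgB _ R[i]^o); first exact: cvg_cst.
apply/cvgC_modulus => e e0.
have : M * 2^-1 ^+ n @[n --> \oo] --> (0 : R).
  apply: (@cvg_geometric R M 2^-1).
  by rewrite ger0_norm// invf_lt1// ltr1n.
move=> /cvgrPdist_lt/(_ _ e0); apply: filterS => n.
rewrite !sub0r normcN normrN => /le_lt_trans; apply.
rewrite (le_trans (nb_eval nbP x (zM n)))// ler_norm//.
Qed.

End closed_graph.
End function_norm_theory.

(** * Square roots of multipliers *)

Section multiplier_square_root.
Variables (R : realType) (X : Type) (nb : (X -> R[i]) -> R -> Prop).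
Hypothesis nbP : function_norm nb.
Variable u : X -> R[i].
Hypothesis uB : forall v, finite_norm nb v -> finite_norm nb (u \* v).

Lemma conj_multiplier v : finite_norm nb v ->
  finite_norm nb ((fun x => (u x)^*) \* v).
Proof.
move=> /(finite_norm_conj nbP)/uB/(finite_norm_conj nbP)[M uvM].
exists M; move: uvM; congr nb; apply/funext => x /=.
by rewrite rmorphM/= conjCK.
Qed.

Section square_root.
Variables (C : R) (C0 : 0 < C).
Hypothesis uC : forall v M, 0 < M -> nb v M -> nb (u \* v) (C * M).

(* With the factor 2, multiplication by q has norm at most 1 / 4, a bound that
   the iteration y keeps because (1 / 4 + 1 / 16) / 2 <= 1 / 4. *)
Let q (x : X) : R := (modulus (u x) / (2 * C)) ^+ 2.

Let y := fix y k (x : X) : R := if k is m.+1 then (q x + y m x ^+ 2) / 2 else 0.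

Let mul_q v M : 0 < M -> nb v M -> nb (fun x => (q x)%:C%C * v x) (M / 4).
Proof.
move=> M0 vM.
have CM0 : 0 < C * M by rewrite mulr_gt0.
have /(uC CM0)/(nb_conj nbP) uuv := nb_conj nbP (uC M0 vM).
have := nb_scale nbP ((2 * C) ^- 2)%:C%C uuv.
have -> : modulus ((2 * C) ^- 2)%:C%C * (C * (C * M)) = M / 4.
  rewrite modulus_real ger0_norm ?invr_ge0 ?sqr_ge0//.
  by field; rewrite gt_eqF.
congr nb; apply/funext => x /=.
rewrite rmorphM/= conjCK /q expr_div_n rmorphM/= mulrC.
rewrite rmorphXn/= -normr_modulus normCK; ring.
Qed.

Let nb_half v M : nb v M -> nb (fun x => (2^-1)%:C%C * v x) (M / 2).
Proof.
move=> /(nb_scale nbP (2^-1)%:C%C); rewrite modulus_real ger0_norm//.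
by rewrite mulrC.
Qed.

Let mul_y k v M : 0 < M -> nb v M -> nb (fun x => (y k x)%:C%C * v x) (M / 4).
Proof.
elim: k v M => [|k IH] v M M0 vM /=.
  under eq_fun do rewrite mul0r.
  by apply: (nb_weaken nbP (nb_zero nbP)); rewrite divr_ge0// ltW.
have M40 : 0 < M / 4 by rewrite divr_gt0.
have := nb_half (nb_add nbP (mul_q M0 vM) (IH _ _ M40 (IH _ _ M0 vM))).
have le : (M / 4 + M / 4 / 4) / 2 <= M / 4 by lra.
move=> /(nb_weaken nbP)/(_ le); congr nb; apply/funext => x /=.
by rewrite !rmorphM !rmorphD/= !rmorphM/=; ring.
Qed.

Let mul_dy k v M : 0 < M -> nb v M ->
  nb (fun x => (y k.+1 x - y k x)%:C%C * v x) (M * 2^-1 ^+ k).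
Proof.
elim: k v M => [|k IH] v M M0 vM.
  have := nb_half (mul_q M0 vM).
  have le : M / 4 / 2 <= M * 2^-1 ^+ 0 by rewrite expr0; lra.
  move=> /(nb_weaken nbP)/(_ le); congr nb; apply/funext => x /=.
  by move: (q x) => qx; rewrite subr0 expr0n/= addr0 rmorphM/=; ring.
have dM0 : 0 < M * 2^-1 ^+ k by rewrite mulr_gt0// exprn_gt0.
have dv := IH _ _ M0 vM.
have := nb_half (nb_add nbP (mul_y k.+1 dM0 dv) (mul_y k dM0 dv)).
have le : (M * 2^-1 ^+ k / 4 + M * 2^-1 ^+ k / 4) / 2 <= M * 2^-1 ^+ k.+1.
  by rewrite exprSr; lra.
move=> /(nb_weaken nbP)/(_ le); congr nb; apply/funext => x.
have -> : y k.+2 x - y k.+1 x =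
    2^-1 * ((y k.+1 x + y k x) * (y k.+1 x - y k x)) by rewrite /=; field.
by rewrite !rmorphM/= rmorphD/=; ring.
Qed.

Let Y (x : X) : R := lim (y k x @[k --> \oo]).

Let y_mul_limit v : finite_norm nb v -> exists2 z, finite_norm nb z &
  forall x, ((y k x)%:C%C * v x : R[i]^o) @[k --> \oo] --> (z x : R[i]^o).
Proof.
move=> [M vM].
have M1 : 0 < `|M| + 1 by rewrite ltr_pwDr.
have {}vM : nb v (`|M| + 1).
  by apply: (nb_weaken nbP vM); rewrite ler_wpDr// ler_norm.
have [k|k|k|z [yz zK]] := nb_limit nbP (x := fun k x => (y k x)%:C%C * v x)
    (r := fun k => (`|M| + 1) * 2^-1 ^+ k).
- have := mul_dy k M1 vM; congr nb; apply/funext => x.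
  by rewrite rmorphB mulrBl.
- by rewrite mulr_gt0// exprn_gt0.
- by rewrite exprSr mulrA.
exists z => //; exists (2 * ((`|M| + 1) * 2^-1 ^+ 0)).
by have := zK 0%N; under eq_fun do rewrite /= mul0r subr0.
Qed.

Let y_cvg v x : finite_norm nb v -> v x != 0 -> y k x @[k --> \oo] --> Y x.
Proof.
move=> vA vx0; have [z _ /(_ x) yz] := y_mul_limit vA.
have : ((y k x)%:C%C * v x * (v x)^-1 : R[i]^o) @[k --> \oo]
    --> (z x * (v x)^-1 : R[i]^o).
  by apply: cvg_complexM; [exact: yz|exact: cvg_cst].
under eq_fun do rewrite mulfK//.
by move=> /cvg_complex[yr _]; apply: cvgP yr.
Qed.

Lemma square_root_of_bound : exists s : X -> R, forall v, finite_norm nb v ->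
  finite_norm nb (fun x => (s x)%:C%C * v x) /\
  forall x, v x != 0 -> s x ^+ 2 = 1 - (modulus (u x) / (2 * C)) ^+ 2.
Proof.
exists (fun x => 1 - Y x) => v vA; split; last first.
  move=> x vx0; have yY := y_cvg vA vx0.
  have YE : Y x = (q x + Y x ^+ 2) / 2.
    have yS : y k.+1 x @[k --> \oo] --> Y x.
      by rewrite (cvg_shiftS (fun k => y k x)).
    apply: (cvg_unique _ yS); first exact: Rhausdorff.
    apply: cvgM; last exact: cvg_cst.
    by apply: cvgD; [exact: cvg_cst|exact: cvgM].
  rewrite -/(q x); have -> : q x = 2 * Y x - Y x ^+ 2.
    by rewrite [in 2 * Y x]YE; field.
  by ring.
have [z zA yz] := y_mul_limit vA.
have -> : (fun x => (1 - Y x)%:C%C * v x) = (fun x => -1 * z x + v x).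
  apply/funext => x; have [vx0|vx0] := eqVneq (v x) 0.
    suff -> : z x = 0 by rewrite vx0 !mulr0 addr0.
    have := yz x; rewrite vx0; under eq_fun do rewrite mulr0.
    move=> yz0; exact: (@cvg_unique _ (@norm_hausdorff _ R[i]^o) _ _ _ _ yz0 (cvg_cst _)).
  suff -> : z x = (Y x)%:C%C * v x by rewrite rmorphB/=; ring.
  apply: (@cvg_unique _ (@norm_hausdorff _ R[i]^o) _ _ _ _ (yz x)).
  apply: cvg_complexM; last exact: cvg_cst.
  apply/cvg_complex; split; first exact: (y_cvg vA).
  exact: cvg_cst.
exact: (finite_normP nbP).
Qed.

End square_root.

(** The square root is s = 1 - y, where y is the limit of the iteration
    y_(k+1) = (|u / c| ^ 2 + y_k ^ 2) / 2: as soon as c is twice a bound of the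
    multiplier u, this iteration contracts in the norm of multiplication
    operators. Pointwise convergence of the y_k is read off from that of the
    y_k v, hence only at points where some v does not vanish. *)
Theorem multiplier_square_root : exists2 c : R, 0 < c &
  exists s : X -> R, forall v, finite_norm nb v ->
    finite_norm nb (fun x => (s x)%:C%C * v x) /\
    forall x, v x != 0 -> s x ^+ 2 = 1 - (modulus (u x) / c) ^+ 2.
Proof.
have [C C0 uC] := multiplication_bounded nbP uB.
by exists (2 * C); [rewrite mulr_gt0|exact: square_root_of_bound].
Qed.

End multiplier_square_root.

(** * Bounded operators and Hilbert spaces *)

Section bounded_operators.
Variable R : realType.
Implicit Types H : completeNormedModType R[i].

Lemma dense_approx (V : normedModType R[i]) (S : set V) (x : V) (e : R[i]) :
  dense S -> 0 < e -> exists2 y, S y & `|x - y| < e.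
Proof.
move=> dS e0; have [|y []] := dS (ball x e)^° _ (open_interior _).
  by exists x; exact: nbhsx_ballx.
by move=> /interior_subset; rewrite -ball_normE /= => xy Sy; exists y.
Qed.

Lemma half_powers_small (e : R[i]) : 0 < e ->
  \forall n \near \oo, (2^-1 ^+ n)%:C%C < e.
Proof.
move=> e0; have eE : e = (complex.Re e)%:C%C by rewrite RRe_real// gtr0_real.
have e0' : 0 < complex.Re e by rewrite -ltcR -eE.
have : 1 * 2^-1 ^+ n @[n --> \oo] --> (0 : R).
  apply: (@cvg_geometric R 1 2^-1).
  by rewrite ger0_norm// invf_lt1// ltr1n.
move=> /cvgrPdist_lt/(_ _ e0'); apply: filterS => n.
by rewrite mul1r sub0r normrN eE ltcR; exact/le_lt_trans/ler_norm.
Qed.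

(** The extension is the closure of the graph. Starting from a relation rather
    than a function spares a separate proof that the operator is well defined
    on its domain: the bound takes care of it. *)
Lemma bounded_graph_extension H (graph : H -> H -> Prop) (M : R[i]) :
  (forall (a : R[i]) x y x' y', graph x y -> graph x' y' ->
    graph (a *: x + x') (a *: y + y')) ->
  0 <= M -> (forall x y, graph x y -> `|y| <= M * `|x|) ->
  dense [set x | exists y, graph x y] ->
  exists2 T, bounded_operator T & forall x y, graph x y -> T x = y.
Proof.
move=> glin M0 gM gdense.
pose P x y := forall e : R[i], 0 < e ->
  exists a b, [/\ graph a b, `|x - a| < e & `|y - b| < e].
have PM x y : P x y -> `|y| <= M * `|x|.
  move=> Pxy; apply/ler_addgt0Pr => e e0.
  have M1 : 0 < 1 + M by rewrite ltr_pwDl.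
  have [a [b [gab xa yb]]] := Pxy _ (divr_gt0 e0 M1).
  have -> : y = (y - b) + b by rewrite subrK.
  rewrite (le_trans (ler_normD _ _))//.
  have -> : M * `|x| + e = e / (1 + M) + M * (`|x| + e / (1 + M)).
    by field; rewrite gt_eqF.
  apply: lerD; first exact: ltW.
  rewrite (le_trans (gM _ _ gab))// ler_wpM2l//.
  have -> : a = x - (x - a) by rewrite opprB addrCA subrr addr0.
  by rewrite (le_trans (ler_normB _ _))// lerD2l ltW.
have Plin (c : R[i]) x y x' y' : P x y -> P x' y' ->
    P (c *: x + x') (c *: y + y').
  move=> Pxy Pxy' e e0.
  have c1 : 0 < 1 + `|c| by rewrite ltr_pwDl.
  have d0 := divr_gt0 e0 c1.
  have [a [b [gab xa yb]]] := Pxy _ d0.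
  have [a' [b' [gab' xa' yb']]] := Pxy' _ d0.
  have small (z z' w w' : H) : `|z - w| < e / (1 + `|c|) ->
      `|z' - w'| < e / (1 + `|c|) -> `|c *: z + z' - (c *: w + w')| < e.
    move=> zw zw'; rewrite opprD addrACA -scalerBr.
    rewrite (le_lt_trans (ler_normD _ _))// normrZ.
    have -> : e = `|c| * (e / (1 + `|c|)) + e / (1 + `|c|).
      by field; rewrite gt_eqF.
    by apply: ler_ltD => //; rewrite ler_wpM2l// ltW.
  by exists (c *: a + a'), (c *: b + b'); split; [exact: glin|exact: small..].
have Puniq x y y' : P x y -> P x y' -> y = y'.
  move=> Pxy Pxy'; have := PM _ _ (Plin (-1) _ _ _ _ Pxy Pxy').
  rewrite !scaleN1r addNr normr0 mulr0 normr_le0 addrC subr_eq0.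
  by move=> /eqP.
have Pex x : exists y, P x y.
  have approx n : exists p : H * H,
      graph p.1 p.2 /\ `|x - p.1| < (2^-1 ^+ n)%:C%C.
    have [|a [b gab] xa] := @dense_approx _ _ x (2^-1 ^+ n)%:C%C gdense.
      by rewrite ltcR exprn_gt0.
    by exists (a, b).
  have [p pP] := choice approx.
  pose b n := (p n).2.
  have cb : cauchy (b @ \oo).
    apply/cauchyP => e e0.
    have M1 : 0 < M *+ 2 + 1 by rewrite ltr_wpDl// mulrn_wge0.
    have [N _ Nsmall] := half_powers_small (divr_gt0 e0 M1).
    exists (b N); exists N => // n /= Nn.
    rewrite -ball_normE /=.
    have [gN xN] := pP N; have [gn xn] := pP n.
    have := gM _ _ (glin (-1) _ _ _ _ gn gN).
    rewrite !scaleN1r addrC [in M * _]addrC => /le_lt_trans; apply.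
    have /ltW sN := Nsmall _ (leqnn N); have /ltW sn := Nsmall _ Nn.
    have d : `|(p N).1 - (p n).1| <= (e / (M *+ 2 + 1)) *+ 2.
      have -> : (p N).1 - (p n).1 = (x - (p n).1) - (x - (p N).1).
        by rewrite opprB [RHS]addrC addrA subrK.
      rewrite (le_trans (ler_normB _ _))// mulr2n lerD//.
        by rewrite (le_trans (ltW xn)).
      by rewrite (le_trans (ltW xN)).
    rewrite (le_lt_trans (ler_wpM2l M0 d))//.
    have {2}-> : e = M * (e / (M *+ 2 + 1) *+ 2) + e / (M *+ 2 + 1).
      rewrite -[X in X = _](divfK (lt0r_neq0 M1)).
      by move: (e / _) => d'; ring.
    by rewrite ltrDl divr_gt0.
  have [y by_] := (cvg_ex _).1 ((cauchy_cvgP _).1 cb).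
  exists y => e e0.
  have [n [xn yn]] : exists n, (2^-1 ^+ n)%:C%C < e /\ `|y - b n| < e.
    have [n _ nP] := filterI (half_powers_small e0) ((cvgrPdist_lt _ _).1 by_ _ e0).
    by exists n; exact: (nP n (leqnn n)).
  exists (p n).1, (p n).2; have [gn xpn] := pP n; split => //.
  exact: lt_trans xpn xn.
have [T TP] := choice Pex.
exists T; last first.
  move=> x y gxy; apply: (Puniq x) => // e e0.
  by exists x, y; rewrite !subrr normr0.
split; last by exists M => x; exact: PM.
by move=> a x y; apply: (Puniq (a *: x + y)) => //; exact: Plin.
Qed.

Lemma bounded_linear_zero (V W : normedModType R[i]) (S : set V) (F : V -> W)
    (M : R[i]) :
  (forall x y, F (x + y) = F x + F y) -> 0 <= M ->
  (forall x, `|F x| <= M * `|x|) -> dense S -> (forall x, S x -> F x = 0) ->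
  forall x, F x = 0.
Proof.
move=> Fadd M0 FM dS F0 x; apply/eqP; rewrite -normr_le0.
apply/ler_addgt0Pr => e e0; rewrite add0r.
have M1 : 0 < 1 + M by rewrite ltr_pwDl.
have [y Sy xy] := dense_approx x dS (divr_gt0 e0 M1).
have -> : x = (x - y) + y by rewrite subrK.
rewrite Fadd (F0 _ Sy) addr0 (le_trans (FM _))//.
rewrite (le_trans (ler_wpM2l M0 (ltW xy)))//.
have {2}-> : e = e / (1 + M) + M * (e / (1 + M)) by field; rewrite gt_eqF.
by rewrite lerDr ltW// divr_gt0.
Qed.

Lemma bounded_operator_ge0 H (T : H -> H) : bounded_operator T ->
  exists2 M, 0 <= M & forall x, `|T x| <= M * `|x|.
Proof.
move=> [Tlin [M TM]].
have [[x x0]|H0] := pselect (exists x : H, x != 0).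
  exists M => //; have := TM x; have x0' : 0 < `|x| by rewrite normr_gt0.
  by move=> /(le_trans (normr_ge0 _)); rewrite pmulr_lge0.
exists 0 => // x; have -> : x = 0.
  by apply: contrapT => /eqP x0; apply: H0; exists x.
have -> : (0 : H) = -1 *: 0 + 0 by rewrite scaler0 addr0.
by rewrite Tlin scaleN1r addNr normr0 mul0r.
Qed.

End bounded_operators.

Section bounded_operator_algebra.
Variables (R : realType) (H : completeNormedModType R[i]).
Implicit Types S T : H -> H.

Lemma bounded_operatorD T x y : bounded_operator T -> T (x + y) = T x + T y.
Proof. by move=> [Tlin _]; have := Tlin 1 x y; rewrite !scale1r. Qed.

Lemma bounded_operator0 T : bounded_operator T -> T 0 = 0.
Proof.
move=> bT; have /eqP := bounded_operatorD 0 0 bT.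
by rewrite addr0 -subr_eq0 opprD addrA subrr sub0r oppr_eq0 => /eqP.
Qed.

Lemma bounded_operatorZ T a x : bounded_operator T -> T (a *: x) = a *: T x.
Proof.
move=> bT; have [Tlin _] := bT; have := Tlin a x 0.
by rewrite !addr0 (bounded_operator0 bT) addr0.
Qed.

Lemma bounded_operator_sum T (I : Type) (s : seq I) (f : I -> H) :
  bounded_operator T -> T (\sum_(i <- s) f i) = \sum_(i <- s) T (f i).
Proof.
move=> bT; apply: (big_morph T); last exact: bounded_operator0.
by move=> x y; exact: bounded_operatorD.
Qed.

Lemma bounded_operator_id : bounded_operator (fun x : H => x).
Proof. by split=> //; exists 1 => x; rewrite mul1r. Qed.

Lemma bounded_operator_lin (a : R[i]) S T : bounded_operator S ->
  bounded_operator T -> bounded_operator (fun x => a *: S x + T x).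
Proof.
move=> bS bT; have [M M0 SM] := bounded_operator_ge0 bS.
have [N N0 TN] := bounded_operator_ge0 bT.
split=> [b x y|].
  by case: bS bT => [Sl _] [Tl _]; rewrite Sl Tl !scalerDr !scalerA mulrC addrACA.
exists (`|a| * M + N) => x; rewrite (le_trans (ler_normD _ _))// mulrDl lerD//.
by rewrite normrZ -mulrA ler_wpM2l.
Qed.

Lemma bounded_operator_comp S T : bounded_operator S -> bounded_operator T ->
  bounded_operator (S \o T).
Proof.
move=> bS bT; have [M M0 SM] := bounded_operator_ge0 bS.
have [N N0 TN] := bounded_operator_ge0 bT.
split=> [b x y|] /=; first by case: bS bT => [Sl _] [Tl _]; rewrite Tl Sl.
exists (M * N) => x; rewrite (le_trans (SM _))// -mulrA ler_wpM2l//.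
Qed.

Lemma bounded_operator_eq (D : set H) S T : bounded_operator S ->
  bounded_operator T -> dense D -> (forall x, D x -> S x = T x) -> S = T.
Proof.
move=> bS bT dD ST; apply/funext => x; apply/esym/eqP; rewrite -subr_eq0.
have bST := bounded_operator_lin (-1) bS bT.
have [M M0 STM] := bounded_operator_ge0 bST.
rewrite addrC -scaleN1r; apply/eqP; move: x.
apply: (bounded_linear_zero (F := fun x => -1 *: S x + T x) _ M0 STM dD).
  by move=> x y; exact: bounded_operatorD bST.
by move=> x Dx; rewrite (ST _ Dx) scaleN1r addNr.
Qed.

End bounded_operator_algebra.

Section hilbert.
Variables (R : realType) (H : completeNormedModType R[i]).
Variable ip : {dot H for Num.conj}.
Hypothesis ipH : hilbert_norm ip.

Lemma ipC x y : ip x y = (ip y x)^*.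
Proof. by rewrite hermC expr0 mul1r. Qed.

Lemma ipDl x y z : ip (x + y) z = ip x z + ip y z.
Proof. exact: linearDl. Qed.

Lemma ipDr x y z : ip x (y + z) = ip x y + ip x z.
Proof. exact: linearD. Qed.

Lemma ipZl a x z : ip (a *: x) z = a * ip x z.
Proof. exact: linearZl_LR. Qed.

Lemma ipZr a x z : ip x (a *: z) = a^* * ip x z.
Proof. by rewrite linearZr_LR. Qed.

Lemma ip_suml (I : Type) (s : seq I) (f : I -> H) z :
  ip (\sum_(i <- s) f i) z = \sum_(i <- s) ip (f i) z.
Proof. exact: linear_sumlz. Qed.

Lemma ip_sumr (I : Type) (s : seq I) (f : I -> H) z :
  ip z (\sum_(i <- s) f i) = \sum_(i <- s) ip z (f i).
Proof. exact: linear_sumr. Qed.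

Lemma ip_cauchy_schwarz x y : `|ip x y| <= `|x| * `|y|.
Proof.
have [->|y0] := eqVneq y 0.
  by rewrite -[0](scale0r 0) ipZr conjC0 mul0r normr0 mulr_ge0.
have yy : 0 < ip y y by rewrite -ipH exprn_gt0// normr_gt0.
pose a := ip x y / ip y y.
have : 0 <= ip (x - a *: y) (x - a *: y) by rewrite -ipH exprn_ge0.
rewrite -scaleNr ipDl !ipDr !ipZl !ipZr rmorphN /a rmorphM/= fmorphV/=.
rewrite -[(ip y y)^*]ipC -ipC.
have -> : ip x x + - (ip y x / ip y y) * ip x y +
    (- (ip x y / ip y y) * ip y x +
     - (ip x y / ip y y) * (- (ip y x / ip y y) * ip y y)) =
    ip x x - ip x y * ip y x / ip y y by field; rewrite gt_eqF.
rewrite subr_ge0 ler_pdivrMr// [ip y x]ipC -normCK -!ipH -exprMn.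
by rewrite ler_sqr ?nnegrE ?mulr_ge0.
Qed.

End hilbert.

(** * Extension of representations to multipliers *)

Section multiplier_representation.
Variables (R : realType) (X : Type) (nb : (X -> R[i]) -> R -> Prop).
Hypothesis nbP : function_norm nb.
Variables (H : completeNormedModType R[i]) (ip : {dot H for Num.conj}).
Hypothesis ipH : hilbert_norm ip.
Variable pi : (X -> R[i]) -> H -> H.
Local Notation A := (finite_norm nb : set (X -> R[i])).
Hypothesis pi_rep : star_representation ip A pi.
Hypothesis pi_nd : nondegenerate_representation A pi.

Let pi_bounded v : A v -> bounded_operator (pi v).
Proof. by case: pi_rep => + _ _ _; exact. Qed.

Let ip_pi f g xi eta : A f -> A g ->
  ip (pi f xi) (pi g eta) = ip xi (pi ((fun x => (f x)^*) \* g) eta).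
Proof.
move=> Af Ag; case: pi_rep => _ _ piM piJ.
by rewrite piJ// piM//; exact: (finite_norm_conj nbP).
Qed.

(** The argument is a family of pairs, not the vector it sums to for u = 1:
    only [rep_sum_bound] shows that this vector determines the sum for u. *)
Definition rep_sum (u : X -> R[i]) (s : seq ({v | A v} * H)) : H :=
  \sum_(p <- s) pi (u \* sval p.1) p.2.

Lemma rep_sum1 s : rep_sum (fun=> 1) s = \sum_(p <- s) pi (sval p.1) p.2.
Proof.
apply: eq_bigr => p _; congr pi; apply/funext => x /=.
by rewrite mul1r.
Qed.

Lemma rep_sum_dense : dense [set rep_sum (fun=> 1) s | s in setT].
Proof.
move=> O O0 oO; have [eta [Oeta [n [c [u [xi [uA etaE]]]]]]] := pi_nd O0 oO.
exists eta; split => //.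
exists [seq (exist _ (u i) (uA i), c i *: xi i) | i <- enum 'I_n] => //.
rewrite rep_sum1 etaE big_map enumT; apply: eq_bigr => i _ /=.
by rewrite bounded_operatorZ//; exact: pi_bounded.
Qed.

Section one_multiplier.
Variable u : X -> R[i].
Hypothesis uB : forall v, A v -> A (u \* v).

(* Moving all functions to the right of the inner product leaves the product
   of s v and s w, that is, that of v and (1 - |u / c| ^ 2) w. *)
Let ip_pi_multiplier (c : R) (s : X -> R) v w xi eta : 0 < c ->
  (forall v, A v -> A (fun x => (s x)%:C%C * v x) /\
    forall x, v x != 0 -> s x ^+ 2 = 1 - (modulus (u x) / c) ^+ 2) ->
  A v -> A w ->
  ip (pi (fun x => (s x)%:C%C * v x) xi) (pi (fun x => (s x)%:C%C * w x) eta) =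
  ip (pi v xi) (pi w eta) -
    (c ^- 2)%:C%C * ip (pi (u \* v) xi) (pi (u \* w) eta).
Proof.
move=> c0 sP Av Aw.
have [svA _] := sP _ Av; have [swA sE] := sP _ Aw.
have uuw : A ((fun x => (u x)^*) \* (u \* w)).
  by apply: (conj_multiplier nbP uB); exact: uB.
have Jv := finite_norm_conj nbP Av.
rewrite !ip_pi//; try exact: uB.
set a := (c ^- 2)%:C%C.
have aJ : (- a)^* = - a.
  by rewrite rmorphN/= conj_Creal//; apply/complex_realP; exists (c ^- 2).
have -> : (fun x => ((s x)%:C%C * v x)^*) \* (fun x => (s x)%:C%C * w x) =
    (fun x => (v x)^*) \*
    (fun x => - a * ((fun x => (u x)^*) \* (u \* w)) x + w x).
  apply/funext => x /=; have [->|wx0] := eqVneq (w x) 0.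
    by rewrite !mulr0 addr0 !mulr0.
  rewrite rmorphM/=.
  have -> : ((s x)%:C%C)^* = (s x)%:C%C :> R[i].
    by rewrite conj_Creal//; apply/complex_realP; exists (s x).
  have -> : (s x)%:C%C * (v x)^* * ((s x)%:C%C * w x) =
      (v x)^* * ((s x ^+ 2)%:C%C * w x) by rewrite rmorphXn/=; ring.
  rewrite (sE _ wx0) rmorphB rmorph1 expr_div_n rmorphM/= rmorphXn/=.
  by rewrite -normr_modulus normCK -/a; ring.
case: pi_rep => _ pilin piM _.
rewrite piM//; last exact: (finite_normP nbP).
rewrite /= pilin// bounded_operatorD ?bounded_operatorZ; try exact: pi_bounded.
rewrite ipDr ipZr aJ addrC mulNr; congr (_ - a * _).
- by rewrite -[LHS]/(ip xi ((pi _ \o pi _) eta)) -piM.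
- rewrite -[LHS]/(ip xi ((pi _ \o pi _) eta)) -piM//; congr (ip _ (pi _ _)).
  by apply/funext => x /=; rewrite rmorphM/=; ring.
Qed.

(** With s = sqrt (1 - |u / c| ^ 2), the squared norm of the sum for 1 exceeds
    c ^ -2 times that of the sum for u by the squared norm of the sum for s,
    which is nonnegative. *)
Lemma rep_sum_bound : exists2 c : R[i], 0 <= c &
  forall s, `|rep_sum u s| <= c * `|rep_sum (fun=> 1) s|.
Proof.
have [c c0 [r rP]] := multiplier_square_root nbP uB.
have c0' : 0 < c%:C%C :> R[i] by rewrite ltcR.
exists c%:C%C => [|s]; first exact: ltW.
pose zeta := \sum_(p <- s) pi (fun x => (r x)%:C%C * sval p.1 x) p.2.
have : 0 <= `|zeta| ^+ 2 by rewrite exprn_ge0.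
have -> : `|zeta| ^+ 2 = `|rep_sum (fun=> 1) s| ^+ 2 -
    (c ^- 2)%:C%C * `|rep_sum u s| ^+ 2.
  rewrite !ipH rep_sum1 /rep_sum /zeta !ip_suml mulr_sumr -sumrB.
  apply: eq_bigr => -[[v Av] xi] _ /=.
  rewrite !ip_sumr mulr_sumr -sumrB.
  by apply: eq_bigr => -[[w Aw] eta] _ /=; exact: ip_pi_multiplier.
rewrite subr_ge0 => le.
rewrite -ler_sqr ?nnegrE ?mulr_ge0 ?(ltW c0')// exprMn.
have -> : `|rep_sum u s| ^+ 2 =
    c%:C%C ^+ 2 * ((c ^- 2)%:C%C * `|rep_sum u s| ^+ 2).
  rewrite fmorphV/= rmorphXn/= mulrA divff ?mul1r//.
  by rewrite expf_neq0// gt_eqF.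
by rewrite ler_wpM2l// exprn_ge0// ltW.
Qed.

Lemma multiplier_operator : exists T : H -> H,
  bounded_operator T /\ forall v, A v -> T \o pi v = pi (u \* v).
Proof.
have [c c0 cP] := rep_sum_bound.
pose graph x y := exists s, x = rep_sum (fun=> 1) s /\ y = rep_sum u s.
have rep_sumZ f a s : (forall v, A v -> A (f \* v)) ->
    a *: rep_sum f s = rep_sum f [seq (p.1, a *: p.2) | p <- s].
  move=> fA; rewrite /rep_sum scaler_sumr big_map; apply: eq_bigr => -[[v Av] xi] _ /=.
  by rewrite bounded_operatorZ//; apply: pi_bounded; exact: fA.
have [|||T bT TP] := @bounded_graph_extension _ _ graph _ _ c0.
- move=> a _ _ _ _ [s [-> ->]] [t [-> ->]].
  exists ([seq (p.1, a *: p.2) | p <- s] ++ t).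
  rewrite /rep_sum !big_cat/=.
  split; congr (_ + _); last exact: rep_sumZ.
  apply: rep_sumZ => v; congr A; apply/funext => x /=; by rewrite mul1r.
- by move=> _ _ [s [-> ->]].
- move=> O O0 oO; have [x [Ox [s _ sx]]] := rep_sum_dense O0 oO.
  by exists x; split => //; exists (rep_sum u s), s.
exists T; split => // v Av; apply/funext => xi /=; apply: TP.
exists [:: (exist _ v Av, xi)].
by rewrite rep_sum1 /rep_sum !big_seq1.
Qed.

End one_multiplier.

Lemma operator_eq_on_range S T : bounded_operator S -> bounded_operator T ->
  (forall v, A v -> S \o pi v = T \o pi v) -> S = T.
Proof.
move=> bS bT ST; apply: (bounded_operator_eq bS bT rep_sum_dense).
move=> _ [s _ <-]; rewrite rep_sum1 !bounded_operator_sum//.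
apply: eq_bigr => -[[v Av] xi] _ /=.
by have /(congr1 (@^~ xi)) := ST _ Av.
Qed.

Lemma functional_eq_on_range (F G : H -> R[i]) (M : R[i]) :
  (forall x y, F (x + y) = F x + F y) -> (forall x y, G (x + y) = G x + G y) ->
  0 <= M -> (forall x, `|F x| <= M * `|x|) -> (forall x, `|G x| <= M * `|x|) ->
  (forall v xi, A v -> F (pi v xi) = G (pi v xi)) -> F =1 G.
Proof.
move=> FD GD M0 FM GM FG x; apply/eqP; rewrite -subr_eq0; apply/eqP.
apply: (@bounded_linear_zero R H R[i]^o _ (fun x => F x - G x) (M + M) _ _ _
  rep_sum_dense).
- by move=> {}x y; rewrite FD GD opprD addrACA.
- exact: addr_ge0.
- by move=> {}x; rewrite (le_trans (ler_normB _ _))// mulrDl lerD.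
- have F0 K : (forall x y, K (x + y) = K x + K y) -> K (0 : H) = 0 :> R[i].
    move=> KD; have := KD 0 0; rewrite addr0 => /eqP.
    by rewrite -subr_eq0 opprD addrA subrr sub0r oppr_eq0 => /eqP.
  move=> _ [s _ <-]; rewrite rep_sum1 (big_morph F FD (F0 _ FD)).
  rewrite (big_morph G GD (F0 _ GD)) -sumrB big1// => -[[v Av] xi] _ /=.
  by rewrite FG// subrr.
Qed.

(** All algebraic identities of the extension follow from uniqueness in the
    intertwining relation, and so does its agreement with pi: for v in the
    represented space, pi v itself solves the relation that defines pit v. The
    adjoint identity is checked on the range of pi and extended by density in
    each variable; nondegeneracy holds because the constant 1 acts as the
    identity. *)
Theorem multiplier_representation (B : set (X -> R[i])) :
  (forall u, B u -> forall v, A v -> A (u \* v)) ->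
  B (fun=> 1) ->
  (forall (a : R[i]) u v, B u -> B v -> B (fun x => a * u x + v x)) ->
  (forall u v, B u -> B v -> B (u \* v)) ->
  (forall u, B u -> B (fun x => (u x)^*)) ->
  exists pit : (X -> R[i]) -> H -> H,
    [/\ forall u, B u ->
          unique (fun T : H -> H => bounded_operator T /\
                    forall v, A v -> T \o pi v = pi (u \* v)) (pit u),
        forall v, A v -> pit v = pi v,
        star_representation ip B pit
      & nondegenerate_representation B pit].
Proof.
move=> BA B1 Blin BM BJ; have [piB pilin piM piJ] := pi_rep.
have ex u : exists T : H -> H, B u ->
    bounded_operator T /\ forall v, A v -> T \o pi v = pi (u \* v).
  have [Bu|nBu] := pselect (B u); last by exists (fun x => x).
  by have [T TP] := multiplier_operator (BA _ Bu); exists T.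
have [ext extP] := choice ex.
pose pit u := if pselect (B u) then ext u else pi u.
have pitE u : B u -> bounded_operator (pit u) /\
    forall v, A v -> pit u \o pi v = pi (u \* v).
  by rewrite /pit; case: pselect => // Bu _; exact: extP.
have pit_uniq u : B u -> unique (fun T : H -> H => bounded_operator T /\
    forall v, A v -> T \o pi v = pi (u \* v)) (pit u).
  move=> Bu; split=> [|T [bT TP]]; first exact: pitE.
  have [bu uP] := pitE _ Bu.
  by apply: operator_eq_on_range => // v Av; rewrite uP// TP.
have pitA v : A v -> pit v = pi v.
  move=> Av; have [Bv|nBv] := pselect (B v); last by rewrite /pit; case: pselect.
  apply: (pit_uniq _ Bv).2; split; first exact: piB.
  by move=> w Aw; rewrite piM.
have pit1 : pit (fun=> 1) = fun x => x.
  apply: (pit_uniq _ B1).2; split; first exact: bounded_operator_id.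
  move=> v Av; apply/funext => xi /=; congr pi; apply/funext => x /=.
  by rewrite mul1r.
exists pit; split => //.
- split.
  + by move=> u Bu; have [] := pitE _ Bu.
  + move=> a u v Bu Bv; have [bu uP] := pitE _ Bu; have [bv vP] := pitE _ Bv.
    apply: (pit_uniq _ (Blin a _ _ Bu Bv)).2; split.
      exact: bounded_operator_lin.
    move=> w Aw; apply/funext => xi /=.
    have /(congr1 (@^~ xi)) /= -> := uP _ Aw.
    have /(congr1 (@^~ xi)) /= -> := vP _ Aw.
    have /(congr1 (@^~ xi)) /= <- := pilin a _ _ (BA _ Bu _ Aw) (BA _ Bv _ Aw).
    by congr pi; apply/funext => x /=; ring.
  + move=> u v Bu Bv; have [bu uP] := pitE _ Bu; have [bv vP] := pitE _ Bv.
    apply: (pit_uniq _ (BM _ _ Bu Bv)).2; split.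
      exact: bounded_operator_comp.
    move=> w Aw; apply/funext => xi /=.
    have /(congr1 (@^~ xi)) /= -> := vP _ Aw.
    have /(congr1 (@^~ xi)) /= -> := uP _ (BA _ Bv _ Aw).
    by congr pi; apply/funext => x /=; rewrite mulrA.
  + move=> u Bu; have BJu := BJ _ Bu.
    have [bu uP] := pitE _ Bu; have [bJ JP] := pitE _ BJu.
    have [M M0 uM] := bounded_operator_ge0 bu.
    have [N N0 JN] := bounded_operator_ge0 bJ.
    have bdl x y : `|ip (pit u x) y| <= (M + N) * `|x| * `|y|.
      rewrite (le_trans (ip_cauchy_schwarz ipH _ _))// ler_wpM2r//.
      by rewrite (le_trans (uM _))// ler_wpM2r// lerDl.
    have bdr x y : `|ip x (pit (fun t => (u t)^*) y)| <= (M + N) * `|x| * `|y|.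
      rewrite (le_trans (ip_cauchy_schwarz ipH _ _))//.
      rewrite [X in _ <= X * _]mulrC -mulrA ler_wpM2l//.
      by rewrite (le_trans (JN _))// ler_wpM2r// lerDr.
    have MN0 z : 0 <= (M + N) * `|z : H| by rewrite mulr_ge0// addr_ge0.
    move=> xi eta; move: xi.
    apply: (@functional_eq_on_range _ _ ((M + N) * `|eta|)) => //.
    * by move=> x y; rewrite bounded_operatorD// ipDl.
    * by move=> x y; rewrite ipDl.
    * by move=> x; rewrite mulrAC.
    * by move=> x; rewrite mulrAC.
    move=> v xi Av; apply: (can_inj (@conjCK _)); rewrite -!ipC; move: eta.
    apply: (@functional_eq_on_range _ _ ((M + N) * `|pi v xi|)) => //.
    * by move=> x y; rewrite ipDl.
    * by move=> x y; rewrite bounded_operatorD// ipDl.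
    * by move=> x; rewrite ipC norm_conjC.
    * by move=> x; rewrite ipC norm_conjC.
    move=> w eta Aw.
    have /(congr1 (@^~ xi)) /= -> := uP _ Av.
    have /(congr1 (@^~ eta)) /= -> := JP _ Aw.
    rewrite !ip_pi//; [|exact: (BA _ BJu)|exact: (BA _ Bu)].
    congr (ip _ (pi _ _)); apply/funext => x /=.
    by rewrite rmorphM/= conjCK; ring.
- move=> O [x Ox] oO; exists x; split => //.
  exists 1%N, (fun=> 1), (fun=> fun=> 1), (fun=> x); split => //.
  by rewrite big_ord1 pit1 scale1r.
Qed.

End multiplier_representation.

(** * Rearrangement of double series *)

Section double_series.
Variable R : realType.

Lemma nnseries_cvgP (u : nat -> R) (s : R) : (forall n, 0 <= u n) ->
  series u @ \oo --> s <-> (\sum_(0 <= n <oo) (u n)%:E = s%:E)%E.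
Proof.
move=> u0.
have E : (fun n => \sum_(0 <= i < n) (u i)%:E)%E = EFin \o series u.
  by apply/funext => n; rewrite /= sumEFin.
split=> [us|us].
  apply: cvg_lim => //; rewrite E; apply: cvg_EFin => //.
  exact: nearW.
have : cvgn (fun n => \sum_(0 <= i < n) (u i)%:E)%E.
  by apply: is_cvg_nneseries => n _ _; rewrite lee_fin.
move=> /cvg_ex[l ul]; have := cvg_lim (@ereal_hausdorff R) ul.
by rewrite us => ls; move: ul; rewrite -ls E => /fine_cvgP[].
Qed.

Variable phi : nat -> nat * nat.
Hypothesis phi_bij : set_bij setT setT phi.

Lemma nneseries_rearrange (a : nat -> nat -> \bar R) :
  (forall k n, 0 <= a k n)%E ->
  (\sum_(0 <= m <oo) a (phi m).1 (phi m).2 =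
   \sum_(0 <= k <oo) \sum_(0 <= n <oo) a k n)%E.
Proof.
move=> a0; rewrite nneseries_esumT// -(reindex_esum _ _ _ (fun p => a p.1 p.2) phi_bij).
rewrite nneseries_esumT; last by move=> k; exact: nneseries_ge0.
under [RHS]eq_esum do rewrite nneseries_esumT//.
rewrite (@esum_esum _ _ _ setT (fun=> setT) a)//.
by congr esum; apply/seteqP; split.
Qed.

Lemma nnseries_rearrange (a : nat -> nat -> R) (A : nat -> R) (S : R) :
  (forall k n, 0 <= a k n) -> (forall k, series (a k) @ \oo --> A k) ->
  series A @ \oo --> S ->
  series (fun m => a (phi m).1 (phi m).2) @ \oo --> S.
Proof.
move=> a0 aA AS; apply/nnseries_cvgP => //.
rewrite (@nneseries_rearrange (fun k n => (a k n)%:E))//.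
have aE k : (\sum_(0 <= n <oo) (a k n)%:E = (A k)%:E)%E by exact/nnseries_cvgP.
under eq_eseriesr do rewrite aE.
apply/nnseries_cvgP => // k.
by rewrite -lee_fin -aE; apply: nneseries_ge0 => n _ _; rewrite lee_fin.
Qed.

Lemma series_add (u v : nat -> R) (s t : R) :
  series u @ \oo --> s -> series v @ \oo --> t ->
  series (fun n => u n + v n) @ \oo --> s + t.
Proof.
move=> us vt; have -> : series (fun n => u n + v n) = series u \+ series v.
  by apply/funext => n; rewrite /series/= big_split.
exact: cvgD.
Qed.

(** Adding the dominating terms reduces to terms of constant sign. *)
Lemma series_rearrange (c a : nat -> nat -> R) (A v : nat -> R) (S w : R) :
  (forall k n, `|c k n| <= a k n) -> (forall k, series (a k) @ \oo --> A k) ->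
  series A @ \oo --> S -> (forall k, series (c k) @ \oo --> v k) ->
  series v @ \oo --> w ->
  series (fun m => c (phi m).1 (phi m).2) @ \oo --> w.
Proof.
move=> ca aA AS cv vw.
have a0 k n : 0 <= a k n by exact: le_trans (ca k n).
have ca0 k n : 0 <= c k n + a k n.
  by have := ca k n; rewrite ler_norml -subr_ge0 opprK addrC => /andP[].
have H := nnseries_rearrange ca0 (fun k => series_add (cv k) (aA k))
  (series_add vw AS).
have -> : series (fun m => c (phi m).1 (phi m).2) =
    series (fun m => c (phi m).1 (phi m).2 + a (phi m).1 (phi m).2) \-
    series (fun m => a (phi m).1 (phi m).2).
  apply/funext => n /=; rewrite /series/= -sumrB.
  by apply: eq_bigr => i _; rewrite addrK.
rewrite -[w](addrK S); apply: cvgB; first exact: H.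
exact: nnseries_rearrange a0 aA AS.
Qed.

Lemma complex_series_rearrange (c : nat -> nat -> R[i]) (a : nat -> nat -> R)
    (A : nat -> R) (v : nat -> R[i]) (S : R) (w : R[i]) :
  (forall k n, modulus (c k n) <= a k n) ->
  (forall k, series (a k) @ \oo --> A k) -> series A @ \oo --> S ->
  (forall k, (series (c k) : nat -> R[i]^o) @ \oo --> (v k : R[i]^o)) ->
  (series v : nat -> R[i]^o) @ \oo --> (w : R[i]^o) ->
  (series (fun m => c (phi m).1 (phi m).2) : nat -> R[i]^o) @ \oo
    --> (w : R[i]^o).
Proof.
move=> ca aA AS cv /cvg_complex_series[vr vi].
apply/cvg_complex_series; split.
  apply: (series_rearrange (c := fun k n => complex.Re (c k n)) _ aA AS _ vr).
    by move=> k n; rewrite (le_trans (Re_le_modulus _)).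
  by move=> k; have /cvg_complex_series[] := cv k.
apply: (series_rearrange (c := fun k n => complex.Im (c k n)) _ aA AS _ vi).
  by move=> k n; rewrite (le_trans (Im_le_modulus _)).
by move=> k; have /cvg_complex_series[] := cv k.
Qed.

End double_series.

(** * Young functions, Borel functions and Haar measure *)

Section young_theory.
Variables (R : realType) (Phi Psi : R -> R).
Hypothesis young : young_function Phi.
Hypothesis compl : complementary Phi Psi.

Lemma young_scale_le (t x : R) : 0 <= t -> t <= 1 -> Phi (t * x) <= t * Phi x.
Proof.
move=> t0 t1; case: young => _ _ conv Phi0 _.
have cE : convex.conv (Itv01 t0 t1) (x : convex_lmodType R^o) 0 = t * x :> R.
  by rewrite /convex.conv/= scaler0 addr0.
have := conv (Itv01 t0 t1) x 0; rewrite cE !in_setT => /(_ isT isT).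
by rewrite convRE/= Phi0 mulr0 addr0.
Qed.

Lemma young_nondecreasing x y : 0 <= x -> x <= y -> Phi x <= Phi y.
Proof.
move=> x0 xy; have [y0|y0] := eqVneq y 0.
  by have -> : x = y by apply/eqP; rewrite eq_le xy y0.
have y_gt0 : 0 < y by rewrite lt_def y0 (le_trans x0).
have t1 : x / y <= 1 by rewrite ler_pdivrMr// mul1r.
have t0 : 0 <= x / y by rewrite divr_ge0// ltW.
have := young_scale_le y t0 t1; rewrite divfK// => /le_trans; apply.
by rewrite ler_piMl//; case: young.
Qed.

Lemma complementary_ge0 y : 0 <= Psi y.
Proof.
rewrite -lee_fin compl; apply: ereal_sup_ubound; exists 0 => //=.
by case: young => _ _ _ -> _; rewrite mul0r subr0.
Qed.

Lemma complementary0 : Psi 0 = 0.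
Proof.
apply/eqP; rewrite eq_le complementary_ge0 andbT -lee_fin compl.
apply: ge_ereal_sup => _ [x _ <-]; rewrite normr0 mulr0 sub0r lee_fin oppr_le0.
by case: young.
Qed.

Lemma complementary_nondecreasing x y : 0 <= x -> x <= y -> Psi x <= Psi y.
Proof.
move=> x0 xy; rewrite -lee_fin compl; apply: ge_ereal_sup => _ [t t0 <-].
rewrite compl; apply: (@le_trans _ _ (t * `|y| - Phi t)%:E).
  rewrite lee_fin lerD2r ler_wpM2l// !ger0_norm//; exact: le_trans xy.
by apply: ereal_sup_ubound; exists t.
Qed.

Lemma young_inequality x y : 0 <= x -> 0 <= y -> x * y <= Phi x + Psi y.
Proof.
move=> x0 y0; rewrite -lerBlDl -lee_fin compl; apply: ereal_sup_ubound.
by exists x => //; rewrite ger0_norm.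
Qed.

End young_theory.

Section borel_functions.
Variables (R : realType) (G : topologicalGroupType).
Implicit Types (f g : G -> R[i]).

Lemma cmeasurable_modulus f : cmeasurable f ->
  measurable_fun setT (fun x : borel G => modulus (f x)).
Proof.
move=> [fr fi].
have -> : (fun x : borel G => modulus (f x)) =
    @Num.sqrt R \o (fun x : borel G => complex.Re (f x) ^+ 2 + complex.Im (f x) ^+ 2).
  by apply/funext => x /=; case: (f x).
apply: measurableT_comp; last first.
  by apply: measurable_funD; exact: measurable_funX.
by apply: nondecreasing_measurable => // x y xy; exact: ler_wsqrtr.
Qed.

Lemma measurable_monotone_modulus (F : R -> R) f :
  (forall s t, 0 <= s -> s <= t -> F s <= F t) -> cmeasurable f ->
  measurable_fun setT (fun x : borel G => (F (modulus (f x)))%:E).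
Proof.
move=> F_nd mf; apply/measurable_EFinP.
have -> : (fun x : borel G => F (modulus (f x))) =
    (fun t => F (Num.max 0 t)) \o (fun x : borel G => modulus (f x)).
  by apply/funext => x /=; rewrite max_r// modulus_ge0.
apply: measurableT_comp; last exact: cmeasurable_modulus.
apply: nondecreasing_measurable => // s t st; apply: F_nd.
  by rewrite le_max lexx.
by rewrite ge_max le_max lexx/= le_max st orbT.
Qed.

Lemma cmeasurableM f g : cmeasurable f -> cmeasurable g ->
  cmeasurable (fun x => f x * g x).
Proof.
move=> [fr fi] [gr gi]; split.
  under eq_fun do rewrite ReM.
  by apply: measurable_funB; exact: measurable_funM.
under eq_fun do rewrite ImM.
by apply: measurable_funD; exact: measurable_funM.
Qed.

Lemma cmeasurable_cst (a : R[i]) : cmeasurable (fun _ : G => a).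
Proof. by split; exact: measurable_cst. Qed.

Lemma cmeasurable_conj f : cmeasurable f -> cmeasurable (fun x => (f x)^*).
Proof.
move=> [fr fi]; split.
  rewrite (_ : (fun x => _) = (fun x => complex.Re (f x)))//.
  by apply/funext => x; case: (f x).
rewrite (_ : (fun x => _) = (fun x => - complex.Im (f x))).
  exact: measurableT_comp.
by apply/funext => x; case: (f x).
Qed.

Lemma measurable_translation (x : G) :
  measurable_fun setT (fun y : borel G => (x * y)%g : borel G).
Proof.
apply: (@measurability _ _ (borel G) (borel G) setT _ (@open G)).
  by [].
move=> _ [U oU <-].
rewrite setTI; apply: sub_sigma_algebra.
apply: open_comp oU => y _.
apply: (@continuous_comp _ _ _ (fun y : G => (x, y))
  (fun p : G * G => (p.1 * p.2)%g)); last exact: mulg_continuous.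
by apply: cvg_pair; [exact: cvg_cst|exact: cvg_id].
Qed.

Lemma cmeasurable_translation f (x : G) : cmeasurable f ->
  cmeasurable (fun y => f (x * y)%g).
Proof.
have mt := measurable_translation x.
by move=> [fr fi]; split; [exact: measurableT_comp fr mt|exact: measurableT_comp fi mt].
Qed.

End borel_functions.

Section haar.
Variables (R : realType) (G : topologicalGroupType).
Variable mu : {measure set (borel G) -> \bar R}.
Hypothesis haar : left_haar mu.

Lemma integral_translation (h : borel G -> \bar R) (x : G) :
  measurable_fun setT h -> (forall y, 0 <= h y)%E ->
  (\int[mu]_y h (x * y)%g = \int[mu]_y h y)%E.
Proof.
move=> mh h0.
have mt := measurable_translation x.
have := @ge0_integral_pushforward _ _ _ _ R _ mt mu setT h measurableT mh
  (fun y _ => h0 y).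
rewrite preimage_setT => <-.
apply: eq_measure_integral => A mA _; rewrite /pushforward.
case: haar => _ _ _ _ /(_ (x^-1)%g _ mA) <-.
congr (mu _); apply/seteqP; split => y /=.
  by move=> Ay; exists (x * y)%g => //; rewrite mulgA mulVg mul1g.
by move=> [z Az <-]; rewrite mulgA mulgV mul1g.
Qed.

End haar.

(** * Integration of complex functions and Orlicz duality *)

Section complex_integral.
Variables (R : realType) (G : topologicalGroupType).
Variable mu : {measure set (borel G) -> \bar R}.
Implicit Types h : G -> R[i].

Definition cintegrable h :=
  cmeasurable h /\ (\int[mu]_y (modulus (h y))%:E < +oo)%E.

Let emeasurable_modulus h : cmeasurable h ->
  measurable_fun setT (fun y : borel G => (modulus (h y))%:E).
Proof. by move=> mh; apply/measurable_EFinP; exact: cmeasurable_modulus. Qed.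

Lemma cintegrable_modulus h : cintegrable h ->
  mu.-integrable setT (EFin \o (fun y : borel G => modulus (h y))).
Proof.
move=> [mh hoo]; apply/integrableP; split; first exact: emeasurable_modulus.
rewrite (le_lt_trans _ hoo)// le_eqVlt; apply/orP; left; apply/eqP.
by apply: eq_integral => y _ /=; rewrite ger0_norm// modulus_ge0.
Qed.

Lemma cintegrable_Re h : cintegrable h ->
  mu.-integrable setT (EFin \o (fun y : borel G => complex.Re (h y))).
Proof.
move=> ih; apply: le_integrable (cintegrable_modulus ih) => //.
  by apply/measurable_EFinP; case: ih => -[].
move=> y _ /=; rewrite lee_fin [leRHS]ger0_norm ?modulus_ge0//.
exact: Re_le_modulus.
Qed.

Lemma cintegrable_Im h : cintegrable h ->
  mu.-integrable setT (EFin \o (fun y : borel G => complex.Im (h y))).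
Proof.
move=> ih; apply: le_integrable (cintegrable_modulus ih) => //.
  by apply/measurable_EFinP; case: ih => -[].
move=> y _ /=; rewrite lee_fin [leRHS]ger0_norm ?modulus_ge0//.
exact: Im_le_modulus.
Qed.

Lemma integral_modulusZ (a : R[i]) h : cmeasurable h ->
  (\int[mu]_y (modulus (a * h y))%:E =
   (modulus a)%:E * \int[mu]_y (modulus (h y))%:E)%E.
Proof.
move=> mh; rewrite -ge0_integralZl_EFin//.
- by apply: eq_integral => y _; rewrite Normc.normcM EFinM.
- by move=> y _; rewrite lee_fin modulus_ge0.
- exact: emeasurable_modulus.
- exact: modulus_ge0.
Qed.

Lemma cintegrableZ (a : R[i]) h : cintegrable h ->
  cintegrable (fun y => a * h y).
Proof.
move=> [mh hoo]; split; first exact: cmeasurableM (cmeasurable_cst _ _) mh.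
rewrite integral_modulusZ// lte_mul_pinfty// lee_fin modulus_ge0//.
Qed.

Lemma cintegralZ (a : R[i]) h : cintegrable h ->
  cintegral mu (fun y => a * h y) = a * cintegral mu h.
Proof.
move=> ih; have iRe := cintegrable_Re ih; have iIm := cintegrable_Im ih.
have iZ (c : R) (k : borel G -> R) : mu.-integrable setT (EFin \o k) ->
    mu.-integrable setT (EFin \o (fun y => c * k y)).
  move=> ik; have := integrableZl measurableT c ik.
  by congr (mu.-integrable _ _).
apply: complex_eqP; rewrite ?ReM ?ImM /cintegral/=.
  under eq_Rintegral do rewrite ReM.
  by rewrite RintegralB ?RintegralZl//; exact: iZ.
under eq_Rintegral do rewrite ImM.
by rewrite RintegralD ?RintegralZl//; exact: iZ.
Qed.

Lemma cintegral_conj h : cintegrable h ->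
  cintegral mu (fun y => (h y)^*) = (cintegral mu h)^*.
Proof.
move=> ih; have iIm := cintegrable_Im ih.
apply: complex_eqP; rewrite /cintegral/=.
  by apply: eq_Rintegral => y _; case: (h y).
rewrite -mulN1r -RintegralZl//.
by apply: eq_Rintegral => y _; rewrite mulN1r; case: (h y).
Qed.

(** The triangle inequality, by rotating the value of the integral onto the
    nonnegative half-line. *)
Lemma modulus_cintegral_le h : cintegrable h ->
  ((modulus (cintegral mu h))%:E <= \int[mu]_y (modulus (h y))%:E)%E.
Proof.
move=> ih; set z := cintegral mu h; have [mh hoo] := ih.
have h_fin : (\int[mu]_y (modulus (h y))%:E)%E \is a fin_num.
  rewrite ge0_fin_numE// integral_ge0// => y _.
  by rewrite lee_fin modulus_ge0.
have [z0|z0] := eqVneq (modulus z) 0.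
  by rewrite z0 integral_ge0// => y _; rewrite lee_fin modulus_ge0.
have z_gt0 : 0 < modulus z by rewrite lt_def z0 modulus_ge0.
rewrite -(fineK h_fin) lee_fin -(ler_pM2l z_gt0).
have iz := cintegrableZ z^* ih.
have -> : modulus z * modulus z = complex.Re (z^* * z).
  rewrite ReM; case: (z) => a b /=.
  rewrite -expr2 sqr_sqrtr ?addr_ge0 ?sqr_ge0// !expr2.
  by rewrite mulNr opprK.
rewrite -/z -cintegralZ// /cintegral/=.
have -> : modulus z * fine (\int[mu]_y (modulus (h y))%:E) =
    \int[mu]_y (modulus (z^* * h y)).
  by rewrite /Rintegral integral_modulusZ// modulus_conj fineM.
apply: le_Rintegral => //; first exact: cintegrable_Re.
  exact: cintegrable_modulus.
by move=> y _; rewrite (le_trans (ler_norm _))// Re_le_modulus.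
Qed.

End complex_integral.

Section orlicz_duality.
Variables (R : realType) (G : topologicalGroupType).
Variable mu : {measure set (borel G) -> \bar R}.
Variables Phi Psi : R -> R.
Hypothesis haar : left_haar mu.
Hypothesis young : young_function Phi.
Hypothesis compl : complementary Phi Psi.
Implicit Types f g : G -> R[i].

Let Phi_ge0 t : 0 <= Phi t. Proof. by case: young. Qed.
Let Phi0 : Phi 0 = 0. Proof. by case: young. Qed.

Lemma modular_zero (Theta : R -> R) (a : R[i]) : Theta 0 = 0 ->
  modular mu Theta (fun x => a * 0) = 0%E.
Proof.
move=> Theta0; rewrite /modular integral0_eq// => x _.
by rewrite mulr0 Normc.normc0 Theta0.
Qed.

Lemma eq_modular (Theta : R -> R) f g :
  (forall x, modulus (f x) = modulus (g x)) ->
  modular mu Theta f = modular mu Theta g.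
Proof. by move=> fg; apply: eq_integral => x _; rewrite fg. Qed.

Lemma orlicz_norm_ge0 g : (0 <= orlicz_norm mu Phi g)%E.
Proof.
apply: ereal_sup_ubound; exists (fun=> 0).
  split; first exact: cmeasurable_cst.
  have := modular_zero 0 Phi0; under eq_fun do rewrite mulr0.
  by move=> ->; rewrite lee_fin.
by rewrite integral0_eq// => x _; rewrite mul0r Normc.normc0.
Qed.

Lemma gauge_norm_ge0 f : (0 <= gauge_norm mu Phi f)%E.
Proof. by apply: le_ereal_inf_tmp => _ [k [k0 _] <-]; rewrite lee_fin ltW. Qed.

Let emeasurable_Phi f : cmeasurable f ->
  measurable_fun setT (fun x : borel G => (Phi (modulus (f x)))%:E).
Proof.
by apply: measurable_monotone_modulus => s t; exact: young_nondecreasing.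
Qed.

Let emeasurable_Psi f : cmeasurable f ->
  measurable_fun setT (fun x : borel G => (Psi (modulus (f x)))%:E).
Proof.
apply: measurable_monotone_modulus => s t.
exact: (complementary_nondecreasing compl).
Qed.

Let emeasurable_modulus f : cmeasurable f ->
  measurable_fun setT (fun x : borel G => (modulus (f x))%:E).
Proof. by move=> mf; apply/measurable_EFinP; exact: cmeasurable_modulus. Qed.

Lemma integral_young f g : cmeasurable f -> cmeasurable g ->
  (\int[mu]_x (modulus (f x * g x))%:E <= modular mu Phi f + modular mu Psi g)%E.
Proof.
move=> mf mg; have Psi_ge0 t : 0 <= Psi t by exact: (complementary_ge0 young).
rewrite -ge0_integralD//; last 4 first.
- by move=> x _; rewrite lee_fin.
- exact: emeasurable_Phi.
- by move=> x _; rewrite lee_fin.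
- exact: emeasurable_Psi.
apply: ge0_le_integral => //.
- by move=> x _; rewrite lee_fin modulus_ge0.
- by apply: emeasurable_modulus; exact: cmeasurableM.
- by apply: emeasurable_funD; [exact: emeasurable_Phi|exact: emeasurable_Psi].
- move=> x _; rewrite -EFinD lee_fin Normc.normcM.
  by apply: (young_inequality compl); exact: modulus_ge0.
Qed.

Let cmeasurableZ (a : R[i]) f : cmeasurable f -> cmeasurable (fun x => a * f x).
Proof. by move=> mf; apply: cmeasurableM => //; exact: cmeasurable_cst. Qed.

(** Finiteness is essential below: since 0 * +oo = 0 in the extended reals, the
    product with a vanishing gauge norm would otherwise bound nothing. *)
Lemma orlicz_norm_lty g : orlicz_space mu Psi g ->
  (orlicz_norm mu Phi g < +oo)%E.
Proof.
move=> [mg [b b0 bg]]; set m := modular _ _ _ in bg.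
apply: (@le_lt_trans _ _ (b^-1%:E * (1 + m))%E); last first.
  by rewrite lte_mul_pinfty ?lee_fin ?invr_ge0 ?ltW// lte_add_pinfty ?ltry.
apply: ge_ereal_sup => _ [f [mf f1] <-].
have -> : (\int[mu]_x (modulus (f x * g x))%:E =
    b^-1%:E * \int[mu]_x (modulus (f x * (b%:C%C * g x)))%:E)%E.
  have -> : (\int[mu]_x (modulus (f x * (b%:C%C * g x)))%:E =
      \int[mu]_x (modulus (b%:C%C * (f x * g x)))%:E)%E.
    by apply: eq_integral => x _; rewrite mulrCA.
  rewrite integral_modulusZ; last exact: cmeasurableM.
  by rewrite modulus_real gtr0_norm// muleA -EFinM mulVf ?mul1e// gt_eqF.
rewrite lee_pmul2l ?lte_fin ?invr_gt0//.
apply: le_trans (integral_young mf (cmeasurableZ _ mg)) _.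
exact: leeD2r.
Qed.

(** By convexity, dividing b f by 1 + m divides its modular m at least as much. *)
Lemma gauge_norm_admissible f : orlicz_space mu Phi f ->
  exists2 k : R, 0 < k & (modular mu Phi (fun x => k^-1%:C%C * f x)%R <= 1)%E.
Proof.
move=> [mf [b b0]]; set m := modular _ _ _ => bf.
have m0 : (0 <= m)%E by apply: integral_ge0 => x _; rewrite lee_fin.
have mE : m = (fine m)%:E by rewrite fineK// ge0_fin_numE.
have fm0 : 0 <= fine m by exact: fine_ge0.
have m1 : 0 < 1 + fine m by rewrite ltr_pwDl.
exists ((1 + fine m) / b); first by rewrite divr_gt0.
apply: (@le_trans _ _ ((1 + fine m)^-1%:E * m)%E); last first.
  by rewrite mE -EFinM lee_fin ler_pdivrMl// mulr1 lerDr.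
rewrite -ge0_integralZl_EFin//; last 3 first.
- by move=> x _; rewrite lee_fin.
- by apply: emeasurable_Phi; exact: cmeasurableZ.
- by rewrite invr_ge0 ltW.
apply: ge0_le_integral => //.
- by move=> x _; rewrite lee_fin.
- by apply: emeasurable_Phi; exact: cmeasurableZ.
- apply: measurable_funeM.
  by apply: emeasurable_Phi; exact: cmeasurableZ.
move=> x _; rewrite -EFinM lee_fin !Normc.normcM !modulus_real.
have -> : `|((1 + fine m) / b)^-1| * modulus (f x) =
    (1 + fine m)^-1 * (`|b| * modulus (f x)).
  rewrite !gtr0_norm ?invr_gt0 ?divr_gt0// invf_div; ring.
apply: (young_scale_le young); first by rewrite invr_ge0 ltW.
by rewrite invf_le1// lerDl.
Qed.

(** The Orlicz norm is defined by duality against the unit ball of the gauge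
    norm; left invariance of the measure moves the translation from g to f,
    where it does not change the modular. *)
Lemma orlicz_holder f g x : orlicz_space mu Phi f -> orlicz_space mu Psi g ->
  (\int[mu]_y (modulus (f y * g (x^-1 * y)%g))%:E <=
   gauge_norm mu Phi f * orlicz_norm mu Phi g)%E.
Proof.
move=> Lf Lg; have [mf _] := Lf; have [mg _] := Lg.
have mgx := cmeasurable_translation (x^-1)%g mg.
have goo := orlicz_norm_lty Lg; have g0 := orlicz_norm_ge0 g.
set I := (\int[mu]_y _)%E.
have kP (k : R) : 0 < k ->
    (modular mu Phi (fun x => k^-1%:C%C * f x)%R <= 1)%E ->
    (I <= k%:E * orlicz_norm mu Phi g)%E.
  move=> k0 kf.
  pose f' y := k^-1%:C%C * f (x * y)%g.
  have mf' : cmeasurable f'.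
    by apply: cmeasurableZ; exact: cmeasurable_translation.
  have -> : I = (k%:E * \int[mu]_y (modulus (f' y * g y))%:E)%E.
    have -> : I = (\int[mu]_y (modulus (f (x * y)%g * g y))%:E)%E.
      rewrite /I -(integral_translation haar x
        (h := fun y => (modulus (f y * g (x^-1 * y)%g))%:E)).
      - by apply: eq_integral => y _; rewrite mulgA mulVg mul1g.
      - by apply: emeasurable_modulus; exact: cmeasurableM.
      - by move=> y; rewrite lee_fin modulus_ge0.
    have -> : (\int[mu]_y (modulus (f' y * g y))%:E =
        \int[mu]_y (modulus (k^-1%:C%C * (f (x * y)%g * g y)))%:E)%E.
      by apply: eq_integral => y _; rewrite mulrA.
    rewrite integral_modulusZ; last first.
      by apply: cmeasurableM => //; exact: cmeasurable_translation.
    rewrite modulus_real gtr0_norm ?invr_gt0// muleA -EFinM.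
    by rewrite divff ?mul1e// gt_eqF.
  rewrite lee_pmul2l ?lte_fin//; apply: ereal_sup_ubound.
  exists f' => //; split=> //.
  rewrite (le_trans _ kf)// le_eqVlt; apply/orP; left; apply/eqP.
  apply: (integral_translation haar x
    (h := fun y => (Phi (modulus (k^-1%:C%C * f y)))%:E)).
  - by apply: emeasurable_Phi; exact: cmeasurableZ.
  - by move=> y; rewrite lee_fin.
have I0 : (0 <= I)%E by apply: integral_ge0 => y _; rewrite lee_fin modulus_ge0.
have NgE : orlicz_norm mu Phi g = (fine (orlicz_norm mu Phi g))%:E.
  by rewrite fineK// ge0_fin_numE.
have [Ng0|Ng0] := eqVneq (fine (orlicz_norm mu Phi g)) 0.
  have [k k0 kf] := gauge_norm_admissible Lf.
  by have := kP _ k0 kf; rewrite NgE Ng0 !mule0.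
have Ng_gt0 : 0 < fine (orlicz_norm mu Phi g) by rewrite lt_def Ng0 fine_ge0.
rewrite NgE -lee_pdivrMr//; apply: le_ereal_inf_tmp => _ [k [k0 kf] <-].
by rewrite lee_pdivrMr// -NgE; exact: kP.
Qed.

Lemma gauge_orlicz_lty f g : orlicz_space mu Phi f -> orlicz_space mu Psi g ->
  (gauge_norm mu Phi f * orlicz_norm mu Phi g < +oo)%E.
Proof.
move=> Lf Lg; have [k k0 kf] := gauge_norm_admissible Lf.
apply: (@le_lt_trans _ _ (k%:E * orlicz_norm mu Phi g)%E).
  apply: lee_wpmul2r; first exact: orlicz_norm_ge0.
  by apply: ereal_inf_lbound; exists k.
by rewrite lte_mul_pinfty ?lee_fin ?(ltW k0)// orlicz_norm_lty.
Qed.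

Lemma conv_cintegrable f g x : orlicz_space mu Phi f -> orlicz_space mu Psi g ->
  cintegrable mu (fun y => f y * g (x^-1 * y)%g).
Proof.
move=> Lf Lg; split; last first.
  exact: le_lt_trans (orlicz_holder x Lf Lg) (gauge_orlicz_lty Lf Lg).
case: Lf Lg => [mf _] [mg _]; apply: cmeasurableM => //.
exact: cmeasurable_translation.
Qed.

Lemma conv_check_le f g x : orlicz_space mu Phi f -> orlicz_space mu Psi g ->
  ((modulus (conv_check mu f g x))%:E <=
   gauge_norm mu Phi f * orlicz_norm mu Phi g)%E.
Proof.
move=> Lf Lg; apply: le_trans (orlicz_holder x Lf Lg).
exact: (modulus_cintegral_le (conv_cintegrable x Lf Lg)).
Qed.

End orlicz_duality.

(** * The norm of A_Phi *)

Section A_Phi_norm.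
Variables (R : realType) (G : topologicalGroupType).
Variable mu : {measure set (borel G) -> \bar R}.
Variables Phi Psi : R -> R.
Hypothesis haar : left_haar mu.
Hypothesis young : young_function Phi.
Hypothesis compl : complementary Phi Psi.
Implicit Types (f g : G -> R[i]) (u v w : G -> R[i]).

(** A bound of the norm of A_Phi, witnessed by one representation. *)
Definition A_Phi_norm_le u (M : R) : Prop :=
  continuous (u : G -> R[i]^o) /\
  exists f g : nat -> G -> R[i],
    [/\ forall n, orlicz_space mu Phi (f n),
        forall n, orlicz_space mu Psi (g n),
        (\sum_(0 <= n <oo) (gauge_norm mu Phi (f n) * orlicz_norm mu Phi (g n))
           <= M%:E)%E
      & forall x, (series (fun n => conv_check mu (f n) (g n) x)
           : nat -> R[i]^o) @ \oo --> (u x : R[i]^o)].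

Let term_ge0 f g : (0 <= gauge_norm mu Phi f * orlicz_norm mu Phi g)%E.
Proof.
by apply: mule_ge0; [exact: gauge_norm_ge0|exact: (orlicz_norm_ge0 _ young)].
Qed.

Lemma A_Phi_finite_norm : A_Phi mu Phi Psi = finite_norm A_Phi_norm_le.
Proof.
apply/seteqP; split=> u /=.
  move=> [cu [f [g [Lf Lg fg us]]]].
  set S := (\sum_(0 <= n <oo) _)%E in fg.
  have S0 : (0 <= S)%E by apply: nneseries_ge0 => n _ _; exact: term_ge0.
  exists (fine S); split=> //; exists f, g; split=> //.
  by rewrite fineK// ge0_fin_numE.
move=> [M [cu [f [g [Lf Lg fg us]]]]]; split=> //; exists f, g; split=> //.
exact: le_lt_trans fg (ltry _).
Qed.

Let fin_term f g : orlicz_space mu Phi f -> orlicz_space mu Psi g ->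
  (gauge_norm mu Phi f * orlicz_norm mu Phi g)%E =
  (fine (gauge_norm mu Phi f * orlicz_norm mu Phi g))%:E.
Proof.
move=> Lf Lg; rewrite fineK// ge0_fin_numE//.
exact: (gauge_orlicz_lty young compl).
Qed.

Let conv_le_term f g x : orlicz_space mu Phi f -> orlicz_space mu Psi g ->
  modulus (conv_check mu f g x) <=
  fine (gauge_norm mu Phi f * orlicz_norm mu Phi g).
Proof.
move=> Lf Lg; rewrite -lee_fin -fin_term//.
exact: (conv_check_le haar young compl).
Qed.

Lemma A_Phi_eval u M x : A_Phi_norm_le u M -> modulus (u x) <= M.
Proof.
move=> [_ [f [g [Lf Lg fg /(_ x) us]]]].
apply: modulus_lim_le us _ => n.
rewrite -lee_fin (le_trans _ fg)//.
apply: le_trans (nneseries_lim_ge n _); last by move=> k _ _; exact: term_ge0.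
elim: n => [|n IH].
  by rewrite /series/= !big_geq// Normc.normc0.
rewrite /series/= !big_nat_recr//=.
apply: (@le_trans _ _ (modulus (\sum_(0 <= k < n) conv_check mu (f k) (g k) x) +
  modulus (conv_check mu (f n) (g n) x))%:E); first by rewrite lee_fin le_normcD.
by rewrite EFinD leeD//; exact: (conv_check_le haar young compl).
Qed.

Lemma orlicz_space0 (Theta : R -> R) : Theta 0 = 0 ->
  orlicz_space mu Theta (fun=> 0).
Proof.
move=> Theta0; split; first exact: cmeasurable_cst.
by exists 1 => //; rewrite modular_zero.
Qed.

Lemma orlicz_spaceZ (Theta : R -> R) (a : R[i]) f : Theta 0 = 0 ->
  orlicz_space mu Theta f -> orlicz_space mu Theta (fun x => a * f x).
Proof.
move=> Theta0 [mf [b b0 bf]].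
have [->|a0] := eqVneq a 0.
  by under eq_fun do rewrite mul0r; exact: orlicz_space0.
split; first by apply: cmeasurableM => //; exact: cmeasurable_cst.
have ma0 : 0 < modulus a.
  rewrite lt_def modulus_ge0 andbT; apply: contra a0 => /eqP ma.
  by apply/eqP; exact: Normc.eq0_normc.
exists (b / modulus a); first by rewrite divr_gt0.
rewrite (_ : modular _ _ _ = modular mu Theta (fun x => b%:C%C * f x))//.
apply: eq_modular => x; rewrite !Normc.normcM !modulus_real.
by rewrite !gtr0_norm ?divr_gt0// mulrA divfK// gt_eqF.
Qed.

Lemma orlicz_space_conj (Theta : R -> R) f :
  orlicz_space mu Theta f -> orlicz_space mu Theta (fun x => (f x)^*).
Proof.
move=> [mf [b b0 bf]]; split; first exact: cmeasurable_conj.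
exists b => //; rewrite (_ : modular _ _ _ = modular mu Theta (fun x => b%:C%C * f x))//.
by apply: eq_modular => x; rewrite !Normc.normcM modulus_conj.
Qed.

Lemma gauge_norm_conj f :
  gauge_norm mu Phi (fun x => (f x)^*) = gauge_norm mu Phi f.
Proof.
congr ereal_inf; congr image; apply/seteqP; split=> k /= [k0 kf]; split=> //;
  rewrite (le_trans _ kf)// le_eqVlt; apply/orP; left; apply/eqP;
  by apply: eq_modular => x; rewrite !Normc.normcM modulus_conj.
Qed.

Lemma orlicz_norm_conj g :
  orlicz_norm mu Phi (fun x => (g x)^*) = orlicz_norm mu Phi g.
Proof.
congr ereal_sup; apply: eq_imagel => f _; apply: eq_integral => x _.
by rewrite !Normc.normcM modulus_conj.
Qed.

Lemma orlicz_normZ_le (a : R[i]) g : cmeasurable g ->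
  (orlicz_norm mu Phi (fun x => a * g x)%R <=
   (modulus a)%:E * orlicz_norm mu Phi g)%E.
Proof.
move=> mg; apply: ge_ereal_sup => _ [f [mf f1] <-].
rewrite (_ : (\int[mu]_x (modulus (f x * (a * g x)))%:E)%E =
  (\int[mu]_x (modulus (a * (f x * g x)))%:E)%E); last first.
  by apply: eq_integral => x _; rewrite mulrCA.
rewrite integral_modulusZ; last exact: cmeasurableM.
rewrite lee_wpmul2l ?lee_fin ?modulus_ge0//.
by apply: ereal_sup_ubound; exists f.
Qed.

Let continuous_scale (a : R[i]) u : continuous (u : G -> R[i]^o) ->
  continuous ((fun x => a * u x) : G -> R[i]^o).
Proof.
by move=> cu x; apply: cvg_complexM; [exact: cvg_cst|exact: cu].
Qed.

Lemma A_Phi_scale (a : R[i]) u M : A_Phi_norm_le u M ->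
  A_Phi_norm_le (fun x => a * u x) (modulus a * M).
Proof.
move=> [cu [f [g [Lf Lg fg us]]]]; split; first exact: continuous_scale.
have Psi0 := complementary0 young compl.
exists f, (fun n x => a * g n x); split; first exact: Lf.
- by move=> n; exact: orlicz_spaceZ.
- apply: (@le_trans _ _ (\sum_(0 <= n <oo) ((modulus a)%:E *
    (gauge_norm mu Phi (f n) * orlicz_norm mu Phi (g n))))%E).
    apply: lee_nneseries => n _ //.
    rewrite muleCA; apply: lee_wpmul2l; first exact: gauge_norm_ge0.
    by apply: orlicz_normZ_le; case: (Lg n).
  rewrite nneseriesZl; last by move=> n _; exact: term_ge0.
  by rewrite EFinM lee_wpmul2l// lee_fin modulus_ge0.
move=> x.
have -> : series (fun n => conv_check mu (f n) (fun y => a * g n y) x) =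
    fun n => a * series (fun n => conv_check mu (f n) (g n) x) n.
  apply/funext => n; rewrite /series/= mulr_sumr; apply: eq_bigr => k _.
  rewrite /conv_check -cintegralZ.
    by congr cintegral; apply/funext => y; rewrite mulrCA.
  exact: (conv_cintegrable haar young compl).
by apply: cvg_complexM; [exact: cvg_cst|exact: us].
Qed.

Lemma A_Phi_conj u M : A_Phi_norm_le u M ->
  A_Phi_norm_le (fun x => (u x)^*) M.
Proof.
move=> [cu [f [g [Lf Lg fg us]]]]; split.
  by move=> x; apply: cvg_conj; exact: cu.
exists (fun n x => (f n x)^*), (fun n x => (g n x)^*); split.
- by move=> n; exact: orlicz_space_conj.
- by move=> n; exact: orlicz_space_conj.
- by under eq_eseriesr do rewrite gauge_norm_conj orlicz_norm_conj.
move=> x.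
have -> : series (fun n => conv_check mu (fun y => (f n y)^*)
      (fun y => (g n y)^*) x) =
    fun n => (series (fun n => conv_check mu (f n) (g n) x) n)^*.
  apply/funext => n; rewrite /series/= rmorph_sum/=; apply: eq_bigr => k _.
  rewrite /conv_check -cintegral_conj.
    by congr cintegral; apply/funext => y; rewrite rmorphM.
  exact: (conv_cintegrable haar young compl).
by apply: cvg_conj; exact: us.
Qed.

Lemma A_Phi_zero : A_Phi_norm_le (fun=> 0) 0.
Proof.
split; first by move=> x; exact: cvg_cst.
have Psi0 := complementary0 young compl.
have Phi0 : Phi 0 = 0 by case: young.
have L0 : orlicz_space mu Psi (fun=> 0) by exact: orlicz_space0.
have g0 : orlicz_norm mu Phi (fun=> 0) = 0%E.
  apply/eqP; rewrite eq_le (orlicz_norm_ge0 _ young) andbT.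
  have := @orlicz_normZ_le 0 (fun=> 0) (cmeasurable_cst _ _).
  by rewrite Normc.normc0 mul0e (_ : (fun=> 0 * 0) = fun=> 0)// mulr0.
exists (fun=> fun=> 0), (fun=> fun=> 0); split; last first.
- move=> x.
  have -> : series (fun n : nat => conv_check mu (fun=> 0) (fun=> 0) x) =
      fun=> 0.
    apply/funext => n; rewrite /series/= big1// => k _.
    rewrite /conv_check.
    have -> : (fun y : G => 0 * 0) = (fun y : G => 0 * (fun=> 0) y :> R[i]) by [].
    rewrite cintegralZ ?mul0r//; split; first exact: cmeasurable_cst.
    by rewrite integral0_eq// => y _; rewrite Normc.normc0.
  exact: cvg_cst.
- by rewrite eseries0// => n _ _; rewrite g0 mule0.
- by move=> _.
- by move=> _; exact: orlicz_space0.
Qed.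

Lemma A_Phi_weaken u (M N : R) : A_Phi_norm_le u M -> M <= N -> A_Phi_norm_le u N.
Proof.
move=> [cu [f [g [Lf Lg fg us]]]] MN; split; first exact: cu.
exists f, g; split; [exact: Lf|exact: Lg| |exact: us].
by rewrite (le_trans fg)// lee_fin.
Qed.

Lemma weierstrass_M_test (v : nat -> G -> R[i]) (M : nat -> R) w (S : R) :
  (forall k, continuous (v k : G -> R[i]^o)) ->
  (forall k x, modulus (v k x) <= M k) -> series M @ \oo --> S ->
  (forall x, (series (fun k => v k x) : nat -> R[i]^o) @ \oo
    --> (w x : R[i]^o)) ->
  continuous (w : G -> R[i]^o).
Proof.
move=> vc vM MS vw x; apply/cvgC_modulus => e e0.
have e30 : 0 < e / 3 by rewrite divr_gt0.
have [K _ /(_ K (leqnn K)) KS] := (cvgrPdist_lt _ _).1 MS _ e30.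
have tail y : modulus (w y - series (fun k => v k y) K) <= S - series M K.
  have shift (V : zmodType) (a : nat -> V) n :
      series a (n + K)%N - series a K = \sum_(K <= k < n + K) a k.
    by rewrite sub_series leq_addl.
  have wy : (series (fun k => v k y) (n + K)%N - series (fun k => v k y) K
      : R[i]^o) @[n --> \oo] --> (w y - series (fun k => v k y) K : R[i]^o).
    apply: (@cvgB _ R[i]^o); last exact: cvg_cst.
    by have := vw y; rewrite -(cvg_shiftn K).
  apply: modulus_lim_le wy _ => n; rewrite shift.
  have M0 k : 0 <= M k by rewrite (le_trans _ (vM k y))// modulus_ge0.
  have Mnd : nondecreasing_seq (series M).
    apply/nondecreasing_seqP => k; rewrite /series/= big_nat_recr//= lerDl//.
  have le : series M (n + K)%N <= S.
    rewrite -(cvg_lim (@Rhausdorff R) MS).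
    by apply: nondecreasing_cvgn_le => //; apply/cvg_ex; exists S.
  apply: le_trans (lerB le (lexx _)); rewrite shift.
  elim: n {le} => [|n IH]; first by rewrite !big_geq// Normc.normc0.
  rewrite addSn !big_nat_recr ?leq_addl//=.
  by rewrite (le_trans (le_normcD _ _))// lerD.
have sc : (fun y => series (fun k => v k y) K : R[i]^o) y @[y --> x] -->
    (series (fun k => v k x) K : R[i]^o).
  rewrite /series/=; elim: K {KS tail} => [|K IH].
    by rewrite big_geq//; under eq_fun do rewrite big_geq//; exact: cvg_cst.
  have sumS y : \sum_(0 <= k < K.+1) v k y = \sum_(0 <= k < K) v k y + v K y.
    by rewrite big_nat_recr.
  rewrite sumS; under eq_fun do rewrite sumS.
  by apply: (@cvgD _ R[i]^o); [exact: IH|exact: vc].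
move/cvgC_modulus : sc => /(_ _ e30); apply: filterS => y xy.
have tail3 z : modulus (w z - series (fun k => v k z) K) < e / 3.
  by rewrite (le_lt_trans (tail z))// (le_lt_trans _ KS)// ler_norm.
have -> : w x - w y = (w x - series (fun k => v k x) K) +
    (series (fun k => v k x) K - series (fun k => v k y) K) -
    (w y - series (fun k => v k y) K) by ring.
rewrite (le_lt_trans (le_normcD _ _))// normcN.
have -> : e = (e / 3 + e / 3) + e / 3 by field.
by rewrite ltrD// (le_lt_trans (le_normcD _ _))// ltrD.
Qed.

(** Representations of all the v_k are merged along an enumeration of the pairs
    of indices. The resulting double series is absolutely convergent at every
    point because each convolution is bounded by the product of the norms of its
    factors. *)
Lemma A_Phi_series (v : nat -> G -> R[i]) (M : nat -> R) w (S : R) :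
  (forall k, A_Phi_norm_le (v k) (M k)) -> series M @ \oo --> S ->
  (forall x, (series (fun k => v k x) : nat -> R[i]^o) @ \oo
    --> (w x : R[i]^o)) ->
  A_Phi_norm_le w S.
Proof.
move=> vM MS vw; split.
  apply: (weierstrass_M_test _ _ MS vw) => [k|k x]; first by case: (vM k).
  exact: A_Phi_eval.
have reps k : exists fg : (nat -> G -> R[i]) * (nat -> G -> R[i]),
    [/\ forall n, orlicz_space mu Phi (fg.1 n),
        forall n, orlicz_space mu Psi (fg.2 n),
        (\sum_(0 <= n <oo) (gauge_norm mu Phi (fg.1 n) *
           orlicz_norm mu Phi (fg.2 n)) <= (M k)%:E)%E
      & forall x, (series (fun n => conv_check mu (fg.1 n) (fg.2 n) x)
           : nat -> R[i]^o) @ \oo --> (v k x : R[i]^o)].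
  by have [_ [f [g fgP]]] := vM k; exists (f, g).
have [fg fgP] := choice reps.
pose f k := (fg k).1; pose g k := (fg k).2.
have Lf k n : orlicz_space mu Phi (f k n) by have [+ _ _ _] := fgP k; exact.
have Lg k n : orlicz_space mu Psi (g k n) by have [_ + _ _] := fgP k; exact.
pose a k n := (gauge_norm mu Phi (f k n) * orlicz_norm mu Phi (g k n))%E.
have a0 k n : (0 <= a k n)%E by exact: term_ge0.
have aM k : (\sum_(0 <= n <oo) a k n <= (M k)%:E)%E by have [] := fgP k.
have M0 k : 0 <= M k.
  by rewrite -lee_fin (le_trans _ (aM k))// nneseries_ge0.
pose r k n := fine (a k n).
have r0 k n : 0 <= r k n by exact: fine_ge0.
have rE k n : a k n = (r k n)%:E by exact: fin_term.
pose A k := fine (\sum_(0 <= n <oo) a k n)%E.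
have AE k : (\sum_(0 <= n <oo) a k n)%E = (A k)%:E.
  by rewrite fineK// ge0_fin_numE ?nneseries_ge0// (le_lt_trans (aM k))// ltry.
have A0 k : 0 <= A k by rewrite fine_ge0// nneseries_ge0.
have rA k : series (r k) @ \oo --> A k.
  by apply/nnseries_cvgP => //; rewrite -AE; apply: eq_eseriesr => n _.
have AM k : A k <= M k by rewrite -lee_fin -AE.
have cA : cvgn (series A).
  by apply: (series_le_cvg A0 M0 AM); apply/cvg_ex; exists S.
have [T AT] := (cvg_ex _).1 cA.
have [phi phi_bij] : exists phi : nat -> nat * nat, set_bij setT setT phi.
  by apply/card_set_bijP; rewrite card_eq_sym; exact: card_nat2.
exists (fun m => f (phi m).1 (phi m).2), (fun m => g (phi m).1 (phi m).2).
split; [by move=> m; exact: Lf|by move=> m; exact: Lg| |].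
  rewrite (nneseries_rearrange phi_bij (a := a))//.
  have <- : (\sum_(0 <= k <oo) (M k)%:E = S%:E)%E by exact/nnseries_cvgP.
  by apply: lee_nneseries => [k _ _|k _]; [apply: nneseries_ge0|exact: aM].
move=> x; apply: (complex_series_rearrange phi_bij
  (c := fun k n => conv_check mu (f k n) (g k n) x) _ rA AT _ (vw x)).
  by move=> k n; exact: conv_le_term.
by move=> k; have [_ _ _] := fgP k; exact.
Qed.

Theorem A_Phi_function_norm : function_norm A_Phi_norm_le.
Proof.
split.
- by move=> u M x; exact: A_Phi_eval.
- exact: A_Phi_zero.
- exact: A_Phi_weaken.
- by move=> a u M; exact: A_Phi_scale.
- exact: A_Phi_conj.
- exact: A_Phi_series.
Qed.

End A_Phi_norm.

(** * The extension theorem *)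

Theorem theorem3p1 (R : realType) (G : topologicalGroupType)
    (mu : {measure set (borel G) -> \bar R}) (Phi Psi : R -> R)
    (H : completeNormedModType R[i]) (ip : {dot H for Num.conj})
    (pi : (G -> R[i]) -> H -> H)
    (A := A_Phi mu Phi Psi) (B := B_Phi mu Phi Psi) :
  hausdorff_space G -> locally_compact [set: G] -> left_haar mu ->
  young_function Phi -> complementary Phi Psi ->
  delta2 G Phi -> delta2 G Psi ->
  hilbert_norm ip ->
  star_representation ip A pi -> nondegenerate_representation A pi ->
  exists pit : (G -> R[i]) -> H -> H,
    [/\ forall u, B u ->
          unique (fun T : H -> H => bounded_operator T /\
                    forall v, A v -> T \o pi v = pi (u \* v)) (pit u),
        forall v, A v -> pit v = pi v,
        star_representation ip B pit
      & nondegenerate_representation B pit].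
Proof.
move=> _ _ haar young compl _ _ ipH pi_rep pi_nd.
have nbP := A_Phi_function_norm haar young compl.
have AE : A = finite_norm (A_Phi_norm_le mu Phi Psi) by exact: A_Phi_finite_norm.
have BA u v : B u -> finite_norm (A_Phi_norm_le mu Phi Psi) v ->
    finite_norm (A_Phi_norm_le mu Phi Psi) (u \* v).
  by move=> [_ uA]; rewrite -AE => /uA.
rewrite AE in pi_rep pi_nd *.
apply: (multiplier_representation nbP ipH pi_rep pi_nd)
  => [u Bu v||a u v Bu Bv|u v Bu Bv|u Bu].
- exact: BA.
- split; first by move=> x; exact: cvg_cst.
  by move=> v; congr A_Phi; apply/funext => x /=; rewrite mul1r.
- split.
    move=> x; apply: (@cvgD _ R[i]^o); last by case: Bv => + _; exact.
    by apply: cvg_complexM; [exact: cvg_cst|case: Bu => + _; exact].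
  move=> w; rewrite -/A AE => wA.
  have := finite_normP nbP a (BA _ _ Bu wA) (BA _ _ Bv wA).
  by congr finite_norm; apply/funext => x /=; ring.
- split.
    by move=> x; apply: cvg_complexM; [case: Bu => + _; exact|case: Bv => + _; exact].
  move=> w; rewrite -/A AE => wA; have := BA _ _ Bu (BA _ _ Bv wA).
  by congr finite_norm; apply/funext => x /=; rewrite mulrA.
- split; first by move=> x; apply: cvg_conj; case: Bu => + _; exact.
  move=> w; rewrite -/A AE; apply: (conj_multiplier nbP).
  by move=> v; exact: BA.
Qed.
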